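(* Let $n\ge2$. Suppose $\mathbb{E}_{P_0}K_{P_0}(X,X)<\infty$ and Stein's identity $\mathbb{E}_{P_0}\xi_{P_0}(X)=0$ holds. Let $P$ be a probability measure on $\mathcal{X}$ with $\mathbb{E}_PK_{P_0}(X,X)<\infty$ and \[ V_P:=\mathbb{E}_{P\otimes P}K_{P_0}(X,Y)^2<\infty, \] where $X,Y\sim P$ are independent, and let $X_1,\dots,X_n$ be i.i.d. from $P$. Then $\mathbb{E}_PU_n=\mathrm{KSD}^2(P_0,P)$. Moreover, with $\theta:=\mathrm{KSD}(P_0,P)$, \[ \operatorname{Var}_P(U_n)\le\frac{4\theta^2V_P^{1/2}}{n}+\frac{2V_P}{n(n-1)}. \] Consequently, \[ \mathbb{E}_P\bigl|\widehat{\mathrm{KSD}}_U-\mathrm{KSD}(P_0,P)\bigr|\le\bigl(\operatorname{Var}_PU_n\bigr)^{1/4}. \] If $\theta>0$, then also \[ \mathbb{E}_P\bigl|\widehat{\mathrm{KSD}}_U-\mathrm{KSD}(P_0,P)\bigr|\le\frac{\bigl(\operatorname{Var}_PU_n\bigr)^{1/2}}{\theta}. \] In particular, at the target ($P=P_0$), \[ \mathbb{E}_{P_0}\bigl|\widehat{\mathrm{KSD}}_U\bigr|\le\left(\frac{2\operatorname{tr}(C_\star^2)}{n(n-1)}\right)^{1/4}\le\sqrt2\,\sqrt{\frac{\|C_\star\|_{\mathrm{HS}}}{n}},\qquad n\ge2. \]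
   Context: $P_0$ is a fixed probability distribution on $\mathcal{X}\subseteq\mathbb{R}^d$ with a continuously differentiable, everywhere positive density $p_0$; its score is $s_0(x)=\nabla\log p_0(x)$. $k\in C^{1,1}(\mathcal{X}\times\mathcal{X})$ is a positive definite kernel with reproducing kernel Hilbert space $\mathcal{H}_k$, and $\mathcal{H}:=\mathcal{H}_k^d$. The Langevin--Stein feature map is $\xi_{P_0}(x):=s_0(x)k(x,\cdot)+\nabla_x k(x,\cdot)\in\mathcal{H}$, and the Stein kernel is $K_{P_0}(x,y):=\langle\xi_{P_0}(x),\xi_{P_0}(y)\rangle_{\mathcal{H}}$. For a probability measure $P$ with $\mathbb{E}_PK_{P_0}(X,X)<\infty$, the Stein mean embedding is the Bochner integral $\mu_P:=\mathbb{E}_P\xi_{P_0}(X)$ and $\mathrm{KSD}(P_0,P):=\|\mu_P\|_{\mathcal{H}}$. Given a sample $X_1,\dots,X_n$, define \[ U_n:=\frac1{n(n-1)}\sum_{i\ne j}K_{P_0}(X_i,X_j),\qquad\widehat{\mathrm{KSD}}_U:=\sqrt{(U_n)_+},\qquad (u)_+=\max(u,0). \] The Stein covariance operator is $C_\star:=\mathbb{E}_{P_0}[\xi_{P_0}(X)\otimes\xi_{P_0}(X)]$ on $\mathcal{H}$, where $a\otimes b$ is the operator $x\mapsto\langle b,x\rangle a$; it is positive, self-adjoint and trace class, and $\|C_\star\|_{\mathrm{HS}}=\operatorname{tr}(C_\star^2)^{1/2}$. *)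

(* Defs.v *)
From HB Require Import structures.
From mathcomp Require Import all_boot all_order all_algebra.
From mathcomp Require Import all_classical all_reals all_analysis.

Set Implicit Arguments.
Unset Strict Implicit.
Unset Printing Implicit Defensive.

Import Order.TTheory GRing.Theory Num.Theory.
Import numFieldNormedType.Exports.

Local Open Scope classical_set_scope.
Local Open Scope ring_scope.

(* [borel_rV R d] is convertible to ['rV[R]_d] and carries its Borel
   sigma-algebra. *)
Notation borel_rV R d := (g_sigma_algebraType (@open 'rV[R]_d)).

Section inner_product.
Context {R : realType} {V : lmodType R}.
Implicit Types (ip : V -> V -> R) (A : V -> V).

Definition inner_product ip :=
  [/\ forall u v, ip u v = ip v u,
      forall a u v w, ip (a *: u + v) w = a * ip u w + ip v w,
      forall u, 0 <= ip u u &
      forall u, ip u u = 0 -> u = 0].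

Definition ipnorm ip (v : V) : R := Num.sqrt (ip v v).

Definition orthonormal_basis ip (E : set V) :=
  [/\ forall e, E e -> ip e e = 1,
      forall e f, E e -> E f -> e <> f -> ip e f = 0 &
      forall v, (forall e, E e -> ip e v = 0) -> v = 0].

Definition onb ip : set V := xget set0 (orthonormal_basis ip).

(* The trace of a positive operator: the terms are nonnegative, and the sum
   does not depend on the basis. *)
Definition trace ip A : \bar R := \esum_(e in onb ip) (ip e (A e))%:E.

Definition hs_norm ip A : \bar R :=
  poweR (\esum_(e in onb ip) (ipnorm ip (A e) ^+ 2)%:E) 2^-1.

(* The rank-one operator a (x) b. *)
Definition tensor ip (a b : V) : V -> V := fun v => ip b v *: a.

End inner_product.

Section bochner.
Context {disp : measure_display} {T : measurableType disp} {R : realType}.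
Context {V : lmodType R}.

Record vsimple (mu : set T -> \bar R) := VSimple {
  vs_size : nat;
  vs_set : 'I_vs_size -> set T;
  vs_val : 'I_vs_size -> V;
  vs_measurable : forall i, measurable (vs_set i);
  vs_finite : forall i, (mu (vs_set i) < +oo)%E }.

Arguments vs_set {mu} v i.
Arguments vs_val {mu} v i.

Definition vs_fun mu (s : vsimple mu) (x : T) : V :=
  \sum_(i < vs_size s) \1_(vs_set s i) x *: vs_val s i.

Definition vs_integral (mu : set T -> \bar R) (D : set T) (s : vsimple mu) : V :=
  \sum_(i < vs_size s) fine (mu (vs_set s i `&` D)) *: vs_val s i.

(* v is the Bochner integral of f over D: the limit of the integrals of simple
   functions that converge to f in L^1. *)
Definition is_bochner (ip : V -> V -> R) (mu : {measure set T -> \bar R})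
    (D : set T) (f : T -> V) (v : V) :=
  exists s : nat -> vsimple mu,
    [/\ forall n, measurable_fun D (fun x => ipnorm ip (f x - vs_fun (s n) x)),
        (fun n => \int[mu]_(x in D) (ipnorm ip (f x - vs_fun (s n) x))%:E)%E
          @ \oo --> 0%E &
        (fun n => ipnorm ip (vs_integral D (s n) - v)) @ \oo --> (0 : R)].

(* [0] when [f] is not Bochner integrable. *)
Definition bochner (ip : V -> V -> R) (mu : {measure set T -> \bar R})
    (D : set T) (f : T -> V) : V :=
  xget 0 (is_bochner ip mu D f).

End bochner.

Section calculus.
Context {R : realType} {d : nat}.
Local Notation Rd := 'rV[R]_d.
Implicit Types (X : set Rd) (p : Rd -> R) (k : Rd -> Rd -> R).

Definition basis_vec (i : 'I_d) : Rd := delta_mx 0 i.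

Definition C1_on X p :=
  forall x, X x -> differentiable p x /\
    forall i, {for x, continuous ('D_(basis_vec i) p)}.

Definition partial1 k (i : 'I_d) (x y : Rd) : R :=
  'D_(basis_vec i) (fun z => k z y) x.

Definition partial2 k (j : 'I_d) (x y : Rd) : R :=
  'D_(basis_vec j) (fun z => k x z) y.

Definition continuous_on2 X k :=
  forall x y, X x -> X y -> {for (x, y), continuous (fun z => k z.1 z.2)}.

(* k, its first order partial derivatives in either argument, and the mixed
   derivatives (one in each argument) exist and are jointly continuous. *)
Definition C11_on X k :=
  [/\ continuous_on2 X k,
      forall i, (forall x y, X x -> X y ->
          derivable (fun z => k z y) x (basis_vec i)) /\
        continuous_on2 X (partial1 k i),
      forall j, (forall x y, X x -> X y ->
          derivable (fun z => k x z) y (basis_vec j)) /\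
        continuous_on2 X (partial2 k j) &
      forall i j, (forall x y, X x -> X y ->
          derivable (fun z => partial1 k i x z) y (basis_vec j)) /\
        continuous_on2 X (partial2 (partial1 k i) j)].

Definition pos_def_kernel X k :=
  (forall x y, X x -> X y -> k x y = k y x) /\
  (forall (m : nat) (x : 'I_m -> Rd) (a : 'I_m -> R), (forall i, X (x i)) ->
    0 <= \sum_(i < m) \sum_(j < m) a i * a j * k (x i) (x j)).

(* Lebesgue measure on R^d is determined by its values on boxes. *)
Definition is_lebesgue (lam : {measure set (borel_rV R d) -> \bar R}) :=
  forall a b : Rd, (forall i, a 0 i <= b 0 i) ->
    lam [set x : Rd | forall i, a 0 i <= x 0 i <= b 0 i] =
    (\prod_(i < d) (b 0 i - a 0 i))%:E.

Definition has_density (P : probability (borel_rV R d) R) X p :=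
  exists2 lam : {measure set (borel_rV R d) -> \bar R}, is_lebesgue lam &
    forall A : set (borel_rV R d), measurable A ->
      P A = (\int[lam]_(x in A `&` X) (p x)%:E)%E.

End calculus.

Section stein.
Context {R : realType} {d : nat} {Hk : completeNormedModType R}.
Local Notation Rd := 'rV[R]_d.
Local Notation H := {ffun 'I_d -> Hk}.
Implicit Types (X : set Rd) (k : Rd -> Rd -> R).
Implicit Types (ip : Hk -> Hk -> R) (ev : Hk -> Rd -> R).

(* [Hk] with inner product [ip] is the RKHS of [k] on [X]; [ev f x] is the
   value f(x), relevant for x in X only. *)
Definition is_rkhs X k ip ev :=
  [/\ inner_product ip /\ (forall f, `|f| = ipnorm ip f),
      forall a f g x, X x -> ev (a *: f + g) x = a * ev f x + ev g x,
      forall f g, (forall x, X x -> ev f x = ev g x) -> f = g &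
      forall x, X x -> exists2 kx : Hk,
        (forall y, X y -> ev kx y = k x y) & (forall f, ev f x = ip f kx)].

(* The element of the RKHS whose values on X are those of g. *)
Definition rkhs_elt X ev (g : Rd -> R) : Hk :=
  xget 0 [set h | forall y, X y -> ev h y = g y].

Definition ipH ip (f g : H) : R := \sum_(i < d) ip (f i) (g i).

Definition score (p0 : Rd -> R) (x : Rd) (i : 'I_d) : R :=
  'D_(basis_vec i) (fun z => ln (p0 z)) x.

(* [partial1 k i x y] is the i-th component of grad_x k(x, .) evaluated at y. *)
Definition stein_feature X ev (p0 : Rd -> R) k (x : Rd) : H :=
  [ffun i => score p0 x i *: rkhs_elt X ev (k x)
             + rkhs_elt X ev (fun y => partial1 k i x y)].

Definition stein_kernel X ip ev (p0 : Rd -> R) k (x y : Rd) : R :=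
  ipH ip (stein_feature X ev p0 k x) (stein_feature X ev p0 k y).

Definition mean_embedding X ip ev (p0 : Rd -> R) k (P : probability (borel_rV R d) R) : H :=
  bochner (ipH ip) P X (stein_feature X ev p0 k).

Definition ksd X ip ev (p0 : Rd -> R) k P : R :=
  ipnorm (ipH ip) (mean_embedding X ip ev p0 k P).

(* The operator-valued expectation of xi(x) (x) xi(x), applied to f. *)
Definition stein_covariance X ip ev (p0 : Rd -> R) k (P0 : probability (borel_rV R d) R)
    (f : H) : H :=
  bochner (ipH ip) P0 X (fun x => tensor (ipH ip)
    (stein_feature X ev p0 k x) (stein_feature X ev p0 k x) f).

End stein.

Section sample.
Context {R : realType} {d n : nat}.
Context {disp : measure_display} {Omega : measurableType disp}.
Local Notation Rd := (borel_rV R d).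

(* The product rule for subfamilies is the case where some A i are setT. *)
Definition iid (Pr : probability Omega R) (P : probability Rd R)
    (X : 'I_n -> {RV Pr >-> Rd}) :=
  (forall i (A : set Rd), measurable A -> distribution Pr (X i) A = P A) /\
  (forall A : 'I_n -> set Rd, (forall i, measurable (A i)) ->
    Pr [set w | forall i, A i (X i w)] =
    (\prod_(i < n) Pr (X i @^-1` A i))%E).

Definition ustat (K : Rd -> Rd -> R) (X : 'I_n -> Omega -> Rd) (w : Omega) : R :=
  (n%:R * (n%:R - 1))^-1 *
  \sum_(i < n) \sum_(j < n | i != j) K (X i w) (X j w).

Definition ksd_hat (K : Rd -> Rd -> R) (X : 'I_n -> Omega -> Rd) (w : Omega) : R :=
  Num.sqrt (Num.max (ustat K X w) 0).

End sample.

(* Main.v *)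
(** Write [xi] for the Stein feature map, [mu] for the mean embedding of [P] and
    [theta = |mu|].  Since [<mu, mu> = E <xi X, xi Y>], the statistic is unbiased
    for [theta ^ 2].  Expanding its variance over two pairs of indices, disjoint
    pairs do not contribute, pairs sharing one index contribute at most
    [S = E <xi X, mu> ^ 2] and equal pairs at most [V].  With
    [m = E (<xi X, mu> xi X)] one has [S = <m, mu> <= |m| theta] and, by
    Cauchy-Schwarz, [|m| ^ 2 = E (<xi X, mu> <xi Y, mu> K(X, Y)) <= S sqrt V],
    hence [S <= theta ^ 2 sqrt V].  The deviation bounds come from
    [|sqrt u - theta| (sqrt u + theta) = |u - theta ^ 2|].

    At the target [theta = 0], and [V <= tr (C ^ 2)]: for finite parts [F] of an
    orthonormal basis, [sum_(e in F) |C e| ^ 2 = E (K(X, Y) <pi_F xi X, xi Y>)],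
    where [pi_F] is the orthogonal projection on the span of [F].  Along a
    suitable sequence of [F]'s, [pi_F] converges to the identity at every value
    of [xi], because [xi] is continuous and thus has a separable range.
    Continuity of [xi] follows from that of its Gram kernel, the derivative
    [d_i k(x, .)] being the limit in the RKHS of difference quotients whose inner
    products are controlled by the mean value theorem in both arguments. *)

Require Import Defs.
From HB Require Import structures.
From mathcomp Require Import all_boot all_order all_algebra.
From mathcomp Require Import all_classical all_reals all_analysis.
From mathcomp Require Import measurable_realfun.
From mathcomp Require Import ring lra.

Set Implicit Arguments.
Unset Strict Implicit.
Unset Printing Implicit Defensive.

Import Order.TTheory GRing.Theory Num.Theory.
Import numFieldNormedType.Exports.

Local Open Scope classical_set_scope.
Local Open Scope ring_scope.

(** * Inner products *)

Section inner_product_theory.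
Context {R : realType} {V : lmodType R} (ip : V -> V -> R).
Context (hip : inner_product ip).
Implicit Types u v w : V.

Local Notation "`[ u ]" := (ipnorm ip u) (format "`[ u ]").

Lemma ipC u v : ip u v = ip v u. Proof. by case: hip. Qed.

Lemma ipDl u v w : ip (u + v) w = ip u w + ip v w.
Proof. by case: hip => _ lin _ _; rewrite -[u]scale1r lin mul1r scale1r. Qed.

Lemma ip0l w : ip 0 w = 0.
Proof. by apply: (@addrI _ (ip 0 w)); rewrite -ipDl !addr0. Qed.

Lemma ipZl a u w : ip (a *: u) w = a * ip u w.
Proof. by case: hip => _ lin _ _; rewrite -[_ *: u]addr0 lin ip0l addr0. Qed.

Lemma ipNl u w : ip (- u) w = - ip u w.
Proof. by rewrite -scaleN1r ipZl mulN1r. Qed.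

Lemma ipBl u v w : ip (u - v) w = ip u w - ip v w.
Proof. by rewrite ipDl ipNl. Qed.

Lemma ip0r w : ip w 0 = 0. Proof. by rewrite ipC ip0l. Qed.

Lemma ipDr u v w : ip w (u + v) = ip w u + ip w v.
Proof. by rewrite ![ip w _]ipC ipDl. Qed.

Lemma ipZr a u w : ip w (a *: u) = a * ip w u.
Proof. by rewrite ![ip w _]ipC ipZl. Qed.

Lemma ipBr u v w : ip w (u - v) = ip w u - ip w v.
Proof. by rewrite ![ip w _]ipC ipBl. Qed.

Lemma ip_suml I (r : seq I) (P : pred I) (F : I -> V) w :
  ip (\sum_(i <- r | P i) F i) w = \sum_(i <- r | P i) ip (F i) w.
Proof. by apply: (big_morph (ip^~ w)) => [u v|]; rewrite (ipDl, ip0l). Qed.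

Lemma ip_ge0 u : 0 <= ip u u. Proof. by case: hip. Qed.

Lemma ip_eq0 u : ip u u = 0 -> u = 0. Proof. by case: hip => _ _ _; exact. Qed.

Lemma ipnorm_ge0 u : 0 <= `[u]. Proof. exact: sqrtr_ge0. Qed.

Lemma sqr_ipnorm u : `[u] ^+ 2 = ip u u.
Proof. by rewrite sqr_sqrtr// ip_ge0. Qed.

Lemma ipnorm0 : `[0 : V] = 0. Proof. by rewrite /ipnorm ip0l sqrtr0. Qed.

Lemma ipnorm0_eq0 u : `[u] = 0 -> u = 0.
Proof. by move=> u0; apply: ip_eq0; rewrite -sqr_ipnorm u0 expr0n. Qed.

Lemma ipnormZ a u : `[a *: u] = `|a| * `[u].
Proof.
by rewrite /ipnorm ipZl ipZr mulrA -expr2 sqrtrM ?sqr_ge0// sqrtr_sqr.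
Qed.

Lemma ipnormN u : `[- u] = `[u].
Proof. by rewrite -scaleN1r ipnormZ normrN1 mul1r. Qed.

Lemma ipnormBC u v : `[u - v] = `[v - u].
Proof. by rewrite -ipnormN opprB. Qed.

(** The squared norm of [<v, v> u - <u, v> v] equals [<v, v> (<u, u> <v, v> - <u, v> ^ 2)] and is
    nonnegative. Scaling by [<v, v>] avoids a division; [v = 0] is treated apart. *)
Lemma ip_cauchy_schwarz u v : `|ip u v| <= `[u] * `[v].
Proof.
have [v0|vN0] := eqVneq (ip v v) 0.
  by rewrite (ip_eq0 v0) ip0r normr0 mulr_ge0// ipnorm_ge0.
have vp : 0 < ip v v by rewrite lt_def vN0 ip_ge0.
rewrite -(ler_pXn2r (ltn0Sn 1)) ?nnegrE ?mulr_ge0 ?ipnorm_ge0//.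
rewrite exprMn !sqr_ipnorm real_normK ?num_real//.
have := ip_ge0 (ip v v *: u - ip u v *: v).
rewrite ipBl !ipBr !ipZl !ipZr (ipC v u) => h.
have {}h : 0 <= ip v v * (ip u u * ip v v - ip u v ^+ 2).
  by apply: le_trans h _; rewrite le_eqVlt; apply/orP; left; apply/eqP; ring.
by rewrite -subr_ge0 -(pmulr_rge0 _ vp).
Qed.

Lemma ip_le_ipnorm u v : ip u v <= `[u] * `[v].
Proof. exact: le_trans (ler_norm _) (ip_cauchy_schwarz _ _). Qed.

Lemma ler_ipnormD u v : `[u + v] <= `[u] + `[v].
Proof.
rewrite -(ler_pXn2r (ltn0Sn 1)) ?nnegrE ?addr_ge0 ?ipnorm_ge0//.
rewrite sqrrD !sqr_ipnorm ipDl !ipDr (ipC v u).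
have := ip_le_ipnorm u v; lra.
Qed.

Lemma ler_ipnormB u v w : `[u - w] <= `[u - v] + `[v - w].
Proof. by rewrite -{1}(subrK v u) -addrA ler_ipnormD. Qed.

Lemma ipnorm_cvg_ip (s : nat -> V) v w :
  (fun n => `[s n - v]) @ \oo --> (0 : R) ->
  (fun n => ip (s n) w) @ \oo --> ip v w.
Proof.
move=> sv; apply/cvgrPdist_le => e e0.
have w0 : 0 < `[w] + 1 by rewrite ltr_wpDl// ipnorm_ge0.
move/cvgrPdist_le : sv => /(_ (e / (`[w] + 1))) []; first exact: divr_gt0.
move=> N _ hN; exists N => // n /hN.
rewrite sub0r normrN ger0_norm ?ipnorm_ge0// => h.
rewrite -ipBl (le_trans (ip_cauchy_schwarz _ _))// ipnormBC.
rewrite (@le_trans _ _ (`[s n - v] * (`[w] + 1)))//.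
  by rewrite ler_wpM2l ?ipnorm_ge0// lerDl.
by rewrite -ler_pdivlMr.
Qed.

(** [V] is a bare module without a topology of its own, so Cauchy sequences and limits are expressed
    through [ipnorm]. *)
Definition ip_complete := forall s : nat -> V,
  (forall e : R, 0 < e -> exists N, forall n m, (N <= n)%N -> (N <= m)%N ->
     `[s n - s m] < e) ->
  exists v, (fun n => `[s n - v]) @ \oo --> (0 : R).

End inner_product_theory.

(** * Real-valued integrals *)

Section real_integral.
Context d (T : measurableType d) (R : realType) (mu : {measure set T -> \bar R}).
Implicit Types f g : T -> R.

Local Notation L1 f := (mu.-integrable setT (EFin \o f)).

Lemma EFin_Rintegral f : L1 f ->
  (\int[mu]_x f x)%:E = (\int[mu]_x (f x)%:E)%E.
Proof. by move=> fi; rewrite fineK// integrable_fin_num. Qed.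

Lemma le_integrable_EFin f g : measurable_fun setT f -> L1 g ->
  (forall x, `|f x| <= g x) -> L1 f.
Proof.
move=> mf gi fg; apply: le_integrable gi => //; first exact/measurable_EFinP.
by move=> x _ /=; rewrite lee_fin (le_trans (fg x))// ler_norm.
Qed.

Lemma integrable_mulr_EFin c f : L1 f -> L1 (fun x => c * f x).
Proof.
by move=> fi; apply: eq_integrable (integrableZl measurableT c fi).
Qed.

Lemma integrableD_EFin f g : L1 f -> L1 g -> L1 (fun x => f x + g x).
Proof.
by move=> fi gi; apply: eq_integrable (integrableD measurableT fi gi).
Qed.

Lemma integrableB_EFin f g : L1 f -> L1 g -> L1 (fun x => f x - g x).
Proof.
by move=> fi gi; apply: eq_integrable (integrableB measurableT fi gi).
Qed.

Lemma integrable_sum_EFin D (mD : measurable D) I (s : seq I) (P : pred I)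
    (h : I -> T -> R) :
  (forall i, P i -> mu.-integrable D (EFin \o h i)) ->
  mu.-integrable D (EFin \o (fun x => \sum_(i <- s | P i) h i x)).
Proof.
move=> hi; rewrite (_ : _ \o _ = (fun x => \sum_(i <- s | P i) (h i x)%:E)%E).
  by apply: integrable_sum => // j /hi.
by apply/funext => x /=; rewrite sumEFin.
Qed.

Lemma Rintegral_sum D (mD : measurable D) I (s : seq I) (P : pred I)
    (h : I -> T -> R) :
  (forall i, P i -> mu.-integrable D (EFin \o h i)) ->
  \int[mu]_(x in D) (\sum_(i <- s | P i) h i x) =
  \sum_(i <- s | P i) \int[mu]_(x in D) h i x.
Proof.
move=> hi; elim: s => [|i s ih].
  by under eq_Rintegral do rewrite big_nil; rewrite /Rintegral integral0 big_nil.
under eq_Rintegral do rewrite big_cons.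
rewrite big_cons; case: ifPn => // Pi; rewrite RintegralD ?ih//; first exact: hi.
exact: integrable_sum_EFin.
Qed.

Lemma integrable_mul_sqr f g :
  measurable_fun setT f -> measurable_fun setT g ->
  L1 (fun x => f x ^+ 2) -> L1 (fun x => g x ^+ 2) -> L1 (fun x => f x * g x).
Proof.
move=> mf mg fi gi; apply: (@le_integrable_EFin _ (fun x => f x ^+ 2 + g x ^+ 2)).
- exact: measurable_funM.
- exact: integrableD_EFin.
move=> x; rewrite ler_norml; apply/andP; split.
  have := sqr_ge0 (f x + g x); nra.
have := sqr_ge0 (f x - g x); nra.
Qed.

(** The integral of [(t f - g) ^ 2] is a quadratic polynomial in [t] that is nonnegative everywhere;
    evaluating it at a suitable [t] gives the bound on its discriminant. *)
Lemma Rintegral_cauchy_schwarz f g :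
  measurable_fun setT f -> measurable_fun setT g ->
  L1 (fun x => f x ^+ 2) -> L1 (fun x => g x ^+ 2) ->
  (\int[mu]_x (f x * g x)) ^+ 2 <=
  (\int[mu]_x (f x ^+ 2)) * (\int[mu]_x (g x ^+ 2)).
Proof.
move=> mf mg fi gi.
have fgi := integrable_mul_sqr mf mg fi gi.
set A := \int[mu]_x (f x ^+ 2); set C := \int[mu]_x (g x ^+ 2).
set B := \int[mu]_x (f x * g x).
have q t : 0 <= t ^+ 2 * A - 2 * t * B + C.
  have <- : \int[mu]_x ((t * f x - g x) ^+ 2) = t ^+ 2 * A - 2 * t * B + C.
    rewrite /A /B /C -!RintegralZl// -RintegralB//; last 2 first.
    - exact: integrable_mulr_EFin.
    - exact: integrable_mulr_EFin.
    rewrite -RintegralD//; first by apply: eq_Rintegral => x _; ring.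
    by apply: integrableB_EFin; exact: integrable_mulr_EFin.
  by apply: Rintegral_ge0 => x _; exact: sqr_ge0.
have A0 : 0 <= A by apply: Rintegral_ge0 => x _; exact: sqr_ge0.
have [A_eq0|AN0] := eqVneq A 0.
  have [->|BN0] := eqVneq B 0; first by rewrite A_eq0 expr0n mul0r.
  (* For [A = 0] the polynomial is affine, and this [t] would give it the value [-1]. *)
  have := q ((C + 1) / (2 * B)).
  have -> : 2 * ((C + 1) / (2 * B)) * B = C + 1 by field.
  by rewrite A_eq0; lra.
have Ap : 0 < A by rewrite lt_def AN0.
(* The minimiser of the quadratic. *)
have := q (B / A).
have -> : (B / A) ^+ 2 * A - 2 * (B / A) * B + C = (A * C - B ^+ 2) / A by field.
by rewrite pmulr_lge0 ?invr_gt0// subr_ge0.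
Qed.

End real_integral.

Section probability_integral.
Context d (T : measurableType d) (R : realType) (P : probability T R).
Implicit Types f g : T -> R.

Local Notation L1 f := (P.-integrable setT (EFin \o f)).

Lemma integrable_cst_EFin c : L1 (fun=> c).
Proof. exact: finite_measure_integrable_cst. Qed.

Lemma Rintegral_cst_probability c : \int[P]_x c = c.
Proof. by rewrite Rintegral_cst//= probability_setT mulr1. Qed.

Lemma integrable_sqr_EFin f : measurable_fun setT f ->
  L1 (fun x => f x ^+ 2) -> L1 f.
Proof.
move=> mf fi; apply: (@le_integrable_EFin _ _ _ _ _ (fun x => 1 + f x ^+ 2)) => //.
  by apply: integrableD_EFin => //; exact: integrable_cst_EFin.
move=> x; rewrite -(real_normK (num_real (f x))).
have := sqr_ge0 (`|f x| - 1); have := normr_ge0 (f x); nra.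
Qed.

(** Cauchy-Schwarz against the constant 1, whose square has integral 1 under a probability. *)
Lemma Rintegral_le_sqrt f : measurable_fun setT f ->
  L1 (fun x => f x ^+ 2) -> \int[P]_x f x <= Num.sqrt (\int[P]_x (f x ^+ 2)).
Proof.
move=> mf fi; have := @Rintegral_cauchy_schwarz _ _ _ P f (cst 1) mf _ fi.
have -> : \int[P]_x (cst 1 x ^+ 2 : R) = 1.
  by under eq_Rintegral do rewrite expr1n; rewrite Rintegral_cst_probability.
under eq_Rintegral do rewrite mulr1.
rewrite mulr1 => h; rewrite (le_trans (ler_norm _))//.
rewrite -sqrtr_sqr ler_wsqrtr// h//; under eq_fun do rewrite expr1n.
exact: integrable_cst_EFin.
Qed.

End probability_integral.

Section law.
Context d1 d2 (T1 : measurableType d1) (T2 : measurableType d2) (R : realType).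
Context (mu : {measure set T1 -> \bar R}) (nu : {measure set T2 -> \bar R}).
Context (Y : T1 -> T2) (mY : measurable_fun setT Y).
Context (Ynu : forall A, measurable A -> mu (Y @^-1` A) = nu A).

Let integral_law f :
  (\int[pushforward mu Y]_y f y = \int[nu]_y f y)%E.
Proof. by apply: eq_measure_integral => A mA _; rewrite -Ynu. Qed.

Lemma integrable_law f : nu.-integrable setT (EFin \o f) ->
  mu.-integrable setT (EFin \o (f \o Y)).
Proof.
move=> /[dup] fi /integrableP[mf foo]; apply/integrableP; split.
  exact: measurableT_comp mf mY.
apply: le_lt_trans foo; rewrite -integral_law.
rewrite ge0_integral_pushforward ?preimage_setT//.
exact: measurableT_comp.
Qed.

Lemma Rintegral_law f : nu.-integrable setT (EFin \o f) ->
  \int[mu]_x f (Y x) = \int[nu]_y f y.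
Proof.
move=> fi; have mf := measurable_int _ fi.
rewrite /Rintegral -integral_law.
by rewrite integral_pushforward ?preimage_setT//; exact: integrable_law.
Qed.

(** Transfers integrability from the sample space to the law, which helps when the integrand is
    easier to dominate as a product of random variables. *)
Lemma integrable_law_inv f : measurable_fun setT f ->
  mu.-integrable setT (EFin \o (f \o Y)) -> nu.-integrable setT (EFin \o f).
Proof.
move=> mf /integrableP[_ foo]; apply/integrableP; split.
  exact/measurable_EFinP.
apply: le_lt_trans foo; rewrite -integral_law.
rewrite ge0_integral_pushforward ?preimage_setT//.
by do 2 apply: measurableT_comp => //.
Qed.

End law.

Section product_integral.
Context d1 d2 (T1 : measurableType d1) (T2 : measurableType d2) (R : realType).
Context (P : probability T1 R) (Q : probability T2 R).

Lemma integrable_prod_mul f g : P.-integrable setT (EFin \o f) ->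
  Q.-integrable setT (EFin \o g) ->
  (P \x Q)%E.-integrable setT (EFin \o (fun z => f z.1 * g z.2)).
Proof.
move=> fi gi.
have mf : measurable_fun setT f by apply/measurable_EFinP; exact: measurable_int fi.
have mg : measurable_fun setT g by apply/measurable_EFinP; exact: measurable_int gi.
apply/integrable12ltyP.
  by apply/measurable_EFinP/measurable_funM; exact: measurableT_comp.
rewrite [ltLHS](_ : _ =
  (\int[P]_x (`|(f x)%:E| * \int[Q]_y `|(g y)%:E|))%E); last first.
  apply: eq_integral => x _ /=; rewrite -ge0_integralZl//.
  - by apply: eq_integral => y _; rewrite /= normrM EFinM.
  - by do 2 apply: measurableT_comp => //.
rewrite ge0_integralZr//; last 2 first.
- by do 2 apply: measurableT_comp => //.
- exact: integral_ge0.
case/integrableP : fi => _ fi; case/integrableP : gi => _ gi.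
by rewrite lte_mul_pinfty// ?integral_ge0// ge0_fin_numE// integral_ge0.
Qed.

(** Sections are required to be integrable at every point, so that each inner integral is finite and
    the real and extended integrals agree pointwise. *)
Lemma Rintegral_fubini f :
  (P \x Q)%E.-integrable setT (EFin \o f) ->
  (forall x, Q.-integrable setT (EFin \o (fun y => f (x, y)))) ->
  \int[(P \x Q)%E]_z f z = \int[P]_x \int[Q]_y f (x, y).
Proof.
move=> fi fxi; rewrite /Rintegral -integral12_prod_meas1//; congr fine.
by apply: eq_integral => x _ /=; rewrite EFin_Rintegral.
Qed.

Lemma Rintegral_prod_mul f g : P.-integrable setT (EFin \o f) ->
  Q.-integrable setT (EFin \o g) ->
  \int[(P \x Q)%E]_z (f z.1 * g z.2) = \int[P]_x f x * \int[Q]_y g y.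
Proof.
move=> fi gi; rewrite Rintegral_fubini//=; first last.
- by move=> x; exact: integrable_mulr_EFin.
- exact: integrable_prod_mul.
by rewrite -RintegralZr//; apply: eq_Rintegral => x _ /=; rewrite RintegralZl.
Qed.

End product_integral.

(** * Joint laws of independent variables *)

Section product_law.
Context dO (Omega : measurableType dO) (R : realType) (Pr : probability Omega R).
Context d1 d2 (T1 : measurableType d1) (T2 : measurableType d2).
Context (P1 : probability T1 R) (P2 : probability T2 R).
Context (Y : Omega -> T1) (Z : Omega -> T2).
Context (mY : measurable_fun setT Y) (mZ : measurable_fun setT Z).

Let YZ w := (Y w, Z w).

Let mYZ : measurable_fun setT YZ. Proof. exact: measurable_fun_pair. Qed.

(** Conditioning on [E]: the measure [Pr (E /\ .) / Pr E], pushed forward by [(Y, Z)], agrees with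
    the product on rectangles, hence everywhere by uniqueness of product measures. Taking for [E] an
    event about further variables gives joint laws of more than two variables. *)
Lemma cond_product_law (E : set Omega) (mE : measurable E) :
  (forall A B, measurable A -> measurable B ->
    Pr (E `&` (Y @^-1` A `&` Z @^-1` B)) = Pr E * (P1 A * P2 B))%E ->
  forall D, measurable D ->
    Pr (E `&` (fun w => (Y w, Z w)) @^-1` D) = (Pr E * (P1 \x P2) D)%E.
Proof.
move=> EAB D mD.
have mD' : measurable ((fun w => (Y w, Z w)) @^-1` D).
  by rewrite -[X in measurable X]setTI; exact: mYZ.
(* A null event cannot be normalised, but then both sides vanish. *)
have [E0|E_neq0] := eqVneq (Pr E) 0%E.
  by rewrite E0 mul0e; apply: subset_measure0 E0 => //; exact: measurableI.
have Efin : Pr E \is a fin_num by exact: fin_num_measure.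
set c := fine (Pr E).
have c0 : 0 < c by rewrite fine_gt0// lt0e E_neq0 measure_ge0 /= ltey_eq Efin.
have Ec : Pr E = c%:E by rewrite fineK.
have ci0 : 0 <= c^-1 by rewrite invr_ge0 ltW.
(* [m] is a function of the proof that the pair is measurable, which the measure
   structure of [pushforward] takes as an argument. *)
pose m : {measure set (T1 * T2) -> \bar R} :=
  mscale (NngNum ci0) (pushforward (mrestr Pr mE) YZ).
rewrite (@product_measure_unique _ _ _ _ _ P1 P2 (m mYZ))//.
  rewrite /m /= /mscale/= /pushforward /mrestr Ec muleA -EFinM.
  by rewrite divff ?gt_eqF// mul1e setIC.
move=> A B mA mB; rewrite /m /= /mscale/= /pushforward /mrestr setIC.
rewrite [X in Pr X](_ : _ = E `&` (Y @^-1` A `&` Z @^-1` B))// EAB//.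
by rewrite Ec muleA -EFinM mulVf ?gt_eqF// mul1e.
Qed.

Lemma product_law :
  (forall A B, measurable A -> measurable B ->
    Pr (Y @^-1` A `&` Z @^-1` B) = P1 A * P2 B)%E ->
  forall D, measurable D ->
    Pr ((fun w => (Y w, Z w)) @^-1` D) = ((P1 \x P2) D)%E.
Proof.
move=> AB D mD; rewrite -[X in Pr X]setTI (@cond_product_law setT)//.
  by rewrite probability_setT mul1e.
by move=> A B mA mB; rewrite setTI AB// probability_setT mul1e.
Qed.

End product_law.

Section iid_laws.
Context dO (Omega : measurableType dO) (R : realType) (Pr : probability Omega R).
Context d (T : measurableType d) (P : probability T R) (n : nat).
Context (X : 'I_n -> Omega -> T) (mX : forall i, measurable_fun setT (X i)).
Context (X_law : forall i A, measurable A -> Pr (X i @^-1` A) = P A).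
Context (X_indep : forall A : 'I_n -> set T, (forall i, measurable (A i)) ->
  Pr [set w | forall i, A i (X i w)] = (\prod_(i < n) Pr (X i @^-1` A i))%E).

(** Independence is given for the full family only; indices outside [s] are padded with [setT],
    which contributes a factor 1. *)
Lemma indep_seq (s : seq 'I_n) (A : 'I_n -> set T) : uniq s ->
  (forall i, measurable (A i)) ->
  Pr [set w | forall i, i \in s -> A i (X i w)] = (\prod_(i <- s) P (A i))%E.
Proof.
move=> us mA; pose A' i := if i \in s then A i else setT.
have mA' i : measurable (A' i) by rewrite /A'; case: ifP.
have -> : [set w | forall i, i \in s -> A i (X i w)] =
          [set w | forall i, A' i (X i w)].
  apply/seteqP; split => w h i.
    by rewrite /A'; case: ifP => // /h.
  by move=> si; have := h i; rewrite /A' si.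
rewrite X_indep// [RHS]big_uniq// [RHS]big_mkcond/=.
apply: eq_bigr => i _; rewrite X_law// /A'; case: ifP => // _.
by rewrite probability_setT.
Qed.

Lemma measurable_pre i A : measurable A -> measurable (X i @^-1` A).
Proof. by move=> mA; rewrite -[X in measurable X]setTI; exact: mX. Qed.

Lemma mpair i j : measurable_fun setT (fun w => (X i w, X j w)).
Proof. exact: measurable_fun_pair. Qed.

(** Repeating an index makes the later branch unreachable, so this one family also serves for two
    and three distinct indices. *)
Let pick4 (i j k : 'I_n) (A B C D : set T) (x : 'I_n) :=
  if x == i then A else if x == j then B else if x == k then C else D.

Let mpick4 i j k A B C D : measurable A -> measurable B -> measurable C ->
  measurable D -> forall x, measurable (pick4 i j k A B C D x).
Proof. by move=> ? ? ? ? x; rewrite /pick4; do 3 case: ifP => // _. Qed.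

Let rect4 i j k l A B C D : uniq [:: i; j; k; l] ->
  measurable A -> measurable B -> measurable C -> measurable D ->
  Pr ((X i @^-1` A `&` X j @^-1` B) `&` (X k @^-1` C `&` X l @^-1` D)) =
  (P A * P B * (P C * P D))%E.
Proof.
move=> u mA mB mC mD; have := indep_seq u (mpick4 i j k mA mB mC mD).
move: u; rewrite /= !inE !negb_or -!andbA.
move=> /and5P[/negbTE ij /negbTE ik /negbTE il /negbTE jk].
move=> /and3P[/negbTE jl /negbTE kl _].
(* A multi-rule that decides every equality test among the four indices. *)
pose E := (eqxx, eq_sym j i, eq_sym k i, eq_sym k j, eq_sym l i, eq_sym l j,
  eq_sym l k, (ij, ik, il, jk, jl, kl)).
have -> : [set w | forall x, x \in [:: i; j; k; l] ->
    pick4 i j k A B C D x (X x w)] =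
    (X i @^-1` A `&` X j @^-1` B) `&` (X k @^-1` C `&` X l @^-1` D).
  apply/seteqP; split => [w h|w [[hA hB] [hC hD]] x].
    have := h i; have := h j; have := h k; have := h l.
    rewrite !inE !eqxx !orbT /pick4 !E.
    by move=> /(_ isT) ? /(_ isT) ? /(_ isT) ? /(_ isT) ?.
  by rewrite !inE /pick4 => /or4P[]/eqP->; rewrite !E.
by move=> ->; rewrite !big_cons big_nil mule1 /pick4 !E !muleA.
Qed.

Let rect3 i k l A C D : uniq [:: i; k; l] ->
  measurable A -> measurable C -> measurable D ->
  Pr (X i @^-1` A `&` (X k @^-1` C `&` X l @^-1` D)) = (P A * (P C * P D))%E.
Proof.
move=> u mA mC mD; have := indep_seq u (mpick4 i i k mA mA mC mD).
move: u; rewrite /= !inE !negb_or -!andbA.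
move=> /and4P[/negbTE ik /negbTE il /negbTE kl _].
pose E := (eqxx, eq_sym k i, eq_sym l i, eq_sym l k, (ik, il, kl)).
have -> : [set w | forall x, x \in [:: i; k; l] ->
    pick4 i i k A A C D x (X x w)] =
    X i @^-1` A `&` (X k @^-1` C `&` X l @^-1` D).
  apply/seteqP; split => [w h|w [hA [hC hD]] x].
    have := h i; have := h k; have := h l.
    rewrite !inE !eqxx !orbT /pick4 !E.
    by move=> /(_ isT) ? /(_ isT) ? /(_ isT) ?.
  by rewrite !inE /pick4 => /or3P[]/eqP->; rewrite !E.
by move=> ->; rewrite !big_cons big_nil mule1 /pick4 !E.
Qed.

Lemma law_pair i j E : i != j -> measurable E ->
  Pr ((fun w => (X i w, X j w)) @^-1` E) = ((P \x P) E)%E.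
Proof.
move=> ij mE; apply: product_law => // A B mA mB.
have u : uniq [:: i; j] by rewrite /= inE ij.
have := indep_seq u (mpick4 i i i mA mA mA mB).
have {u}ji : j == i = false by rewrite eq_sym; exact: negbTE.
rewrite !big_cons big_nil mule1 /pick4 eqxx ji => <-.
congr (Pr _); apply/seteqP; split => [w [hA hB] x|w h].
  by rewrite !inE => /orP[]/eqP->; rewrite ?eqxx// ji.
have := h i; have := h j; rewrite !inE !eqxx orbT ji.
by move=> /(_ isT) ? /(_ isT) ?.
Qed.

Lemma law_triple i k l E : uniq [:: i; k; l] -> measurable E ->
  Pr ((fun w => (X i w, (X k w, X l w))) @^-1` E) = ((P \x (P \x P)) E)%E.
Proof.
move=> u mE; apply: product_law => //; first exact: mpair.
move=> A B mA mB; rewrite -(X_law i)//.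
apply: cond_product_law => //; first exact: measurable_pre.
by move=> C D mC mD; rewrite X_law//; exact: rect3.
Qed.

(** Two conditionings are nested. Conditioning on a rectangle event for [(X k, X l)] extends the
    product rule to any measurable set of values of [(X i, X j)]; conditioning on the resulting
    event then does the same for [(X k, X l)]. *)
Lemma law_quadruple i j k l E : uniq [:: i; j; k; l] -> measurable E ->
  Pr ((fun w => ((X i w, X j w), (X k w, X l w))) @^-1` E) =
  (((P \x P) \x (P \x P)) E)%E.
Proof.
move=> u mE; apply: product_law => //; [exact: mpair|exact: mpair|].
have ij : i != j by move: u; rewrite /= inE negb_or => /and3P[/andP[]].
have kl : k != l by move: u; rewrite /= !inE => /and4P[].
move=> A B mA mB; rewrite -[X in _ = (X * _)%E](law_pair ij mA).
have mA' : measurable ((fun w => (X i w, X j w)) @^-1` A).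
  by rewrite -[X in measurable X]setTI; exact: mpair.
apply: cond_product_law => // C D mC mD.
have mCD : measurable (X k @^-1` C `&` X l @^-1` D).
  by apply: measurableI; exact: measurable_pre.
have CD : Pr (X k @^-1` C `&` X l @^-1` D) = (P C * P D)%E.
  by rewrite -product_measure1E// -[RHS](law_pair kl (measurableX mC mD)).
rewrite setIC (cond_product_law (mX i) (mX j) (P1 := P) (P2 := P) mCD)//.
  by rewrite CD muleC -[X in _ = (X * _)%E]/(Pr _) (law_pair ij mA).
move=> A' B' mA'' mB'; rewrite setIC rect4// CD; exact: muleC.
Qed.

End iid_laws.

(** * Mean and variance of a U-statistic *)

Section ustat_moments.
Context dO (Omega : measurableType dO) (R : realType) (Pr : probability Omega R).
Context d (T : measurableType d) (P : probability T R) (n : nat).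
Context (X : 'I_n -> Omega -> T) (mX : forall i, measurable_fun setT (X i)).
Context (X_law : forall i A, measurable A -> Pr (X i @^-1` A) = P A).
Context (X_indep : forall A : 'I_n -> set T, (forall i, measurable (A i)) ->
  Pr [set w | forall i, A i (X i w)] = (\prod_(i < n) Pr (X i @^-1` A i))%E).
Context (K : T -> T -> R) (Ksym : forall x y, K x y = K y x).
Context (mK : measurable_fun setT (fun z : T * T => K z.1 z.2)).
Context (K2 : (P \x P)%E.-integrable setT (EFin \o (fun z => K z.1 z.2 ^+ 2))).
Context (Kx : forall x, P.-integrable setT (EFin \o K x)).

Let m1 := \int[(P \x P)%E]_z K z.1 z.2.
Let V := \int[(P \x P)%E]_z (K z.1 z.2 ^+ 2).
Let S := \int[P]_x ((\int[P]_y K x y) ^+ 2).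
(* Unification does not find the measure structure of a nested product from its
   bare expression. *)
Let P2 : probability (T * T)%type R := (P \x P)%E.
Let P3 : probability (T * (T * T))%type R := (P \x P2)%E.
Let P4 : probability ((T * T) * (T * T))%type R := (P2 \x P2)%E.
Let KX (p : 'I_n * 'I_n) w := K (X p.1 w) (X p.2 w).

Let intK : (P \x P)%E.-integrable setT (EFin \o (fun z => K z.1 z.2)).
Proof. exact: integrable_sqr_EFin. Qed.

Let mKX p : measurable_fun setT (KX p).
Proof.
exact: (measurableT_comp mK (mpair mX p.1 p.2)).
Qed.

Let KX1 p : p.1 != p.2 ->
  Pr.-integrable setT (EFin \o KX p) /\ \int[Pr]_w KX p w = m1.
Proof.
move=> p12; have law E := law_pair mX X_law X_indep (E := E) p12.
have mp := mpair mX p.1 p.2.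
by split; [exact: (integrable_law mp law intK)|exact: (Rintegral_law mp law intK)].
Qed.

Let KX2 p : p.1 != p.2 -> Pr.-integrable setT (EFin \o (fun w => KX p w ^+ 2)) /\
  \int[Pr]_w (KX p w ^+ 2) = V.
Proof.
move=> p12; have law E := law_pair mX X_law X_indep (E := E) p12.
have mp := mpair mX p.1 p.2.
by split; [exact: (integrable_law mp law K2)|exact: (Rintegral_law mp law K2)].
Qed.

Let KXM p q : p.1 != p.2 -> q.1 != q.2 ->
  Pr.-integrable setT (EFin \o (fun w => KX p w * KX q w)).
Proof.
by move=> /KX2[p2 _] /KX2[q2 _]; exact: integrable_mul_sqr.
Qed.

(** For a fixed value of the shared variable the two factors are independent with the same mean, so
    the inner integral is the square of that mean. *)
Let KX_share i k l : uniq [:: i; k; l] ->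
  \int[Pr]_w (KX (i, k) w * KX (i, l) w) = S.
Proof.
move=> u; have law E := law_triple mX X_law X_indep (E := E) u.
pose f (z : T * (T * T)) := K z.1 z.2.1 * K z.1 z.2.2.
have mf : measurable_fun setT f.
  apply: measurable_funM.
    apply: (measurableT_comp mK (g := fun z : T * (T * T) => (z.1, z.2.1))).
    by apply: measurable_fun_pair => //; exact: measurableT_comp.
  apply: (measurableT_comp mK (g := fun z : T * (T * T) => (z.1, z.2.2))).
  by apply: measurable_fun_pair => //; exact: measurableT_comp.
have mYZ : measurable_fun setT (fun w => (X i w, (X k w, X l w))).
  by apply: measurable_fun_pair => //; exact: mpair.
(* Integrability is established on the sample space, where the integrand is a product of two square
   integrable variables. *)
have fi : P3.-integrable setT (EFin \o f).
  apply: (integrable_law_inv (nu := P3) mYZ law mf); apply: (@KXM (i, k) (i, l)).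
    by move: u; rewrite /= !inE negb_or => /andP[/andP[]].
  by move: u; rewrite /= !inE negb_or => /andP[/andP[]].
rewrite -[LHS]/(\int[Pr]_w f (X i w, (X k w, X l w))).
rewrite (Rintegral_law (nu := P3) mYZ law fi) Rintegral_fubini// => [|x].
  by apply: eq_Rintegral => x _; exact: (Rintegral_prod_mul (Kx x) (Kx x)).
exact: (integrable_prod_mul (Kx x) (Kx x)).
Qed.

Let KX_disjoint i j k l : uniq [:: i; j; k; l] ->
  \int[Pr]_w (KX (i, j) w * KX (k, l) w) = m1 ^+ 2.
Proof.
move=> u; have law E := law_quadruple mX X_law X_indep (E := E) u.
pose f (z : (T * T) * (T * T)) := K z.1.1 z.1.2 * K z.2.1 z.2.2.
have mYZ : measurable_fun setT (fun w => ((X i w, X j w), (X k w, X l w))).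
  by apply: measurable_fun_pair; exact: mpair.
rewrite -[LHS]/(\int[Pr]_w f ((X i w, X j w), (X k w, X l w))).
have fi : P4.-integrable setT (EFin \o f) by exact: (integrable_prod_mul intK intK).
rewrite (Rintegral_law (nu := P4) mYZ law fi).
exact: (Rintegral_prod_mul intK intK).
Qed.

Let S_ge0 : 0 <= S. Proof. by apply: Rintegral_ge0 => x _; exact: sqr_ge0. Qed.

Let V_ge0 : 0 <= V. Proof. by apply: Rintegral_ge0 => x _; exact: sqr_ge0. Qed.

Let KXC i j : KX (i, j) = KX (j, i).
Proof. by apply/funext => w; rewrite /KX Ksym. Qed.

(** Case analysis on coincidences of indices, with symmetry of [K] moving the shared index to the
    front. The indicators overcount when the pairs coincide up to order; this only enlarges the
    bound, since [S >= 0], and it makes the later count a clean [4 (n - 1)]. *)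
Let cov_le i j k l : i != j -> k != l ->
  \int[Pr]_w (KX (i, j) w * KX (k, l) w) - m1 ^+ 2 <=
  S * ((k == i)%:R + (k == j)%:R + (l == i)%:R + (l == j)%:R) +
  V * (((k, l) == (i, j))%:R + ((k, l) == (j, i))%:R).
Proof.
move=> ij kl; have m2 := sqr_ge0 m1; have S0 := S_ge0; have V0 := V_ge0.
rewrite !xpair_eqE.
have KX2V : \int[Pr]_w (KX (i, j) w * KX (i, j) w) = V.
  by under eq_Rintegral do rewrite -expr2; case: (@KX2 (i, j) ij).
have [ki|ki] := eqVneq k i.
  subst k; have [lj|lj] := eqVneq l j.
    subst l; rewrite KX2V (negbTE ij) [j == i]eq_sym (negbTE ij) /=; lra.
  rewrite KX_share; first by rewrite (negbTE ij) eq_sym (negbTE kl) /=; lra.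
  by rewrite /= !inE negb_or ij kl eq_sym lj.
have [kj|kj] := eqVneq k j.
  subst k; rewrite [KX (i, j)]KXC; have [li|li] := eqVneq l i.
    subst l; rewrite -[KX (j, i)]KXC KX2V (negbTE ij) /=; lra.
  rewrite KX_share; first by rewrite eq_sym (negbTE kl) /=; lra.
  by rewrite /= !inE negb_or eq_sym ij kl eq_sym li.
have [li|li] := eqVneq l i.
  subst l; rewrite [KX (k, i)]KXC KX_share; first by rewrite (negbTE ij) /=; lra.
  by rewrite /= !inE negb_or ij eq_sym ki eq_sym kj.
have [lj|lj] := eqVneq l j.
  subst l; rewrite [KX (k, j)]KXC [KX (i, j)]KXC KX_share; first by rewrite /=; lra.
  by rewrite /= !inE negb_or eq_sym ij eq_sym kj eq_sym ki.
rewrite KX_disjoint /=; first lra.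
by rewrite !inE !negb_or ij kl !(eq_sym i) ki li !(eq_sym j) kj lj.
Qed.

Let off (p : 'I_n * 'I_n) := p.1 != p.2.

Let sum_off (F : 'I_n * 'I_n -> R) :
  \sum_(p | off p) F p = \sum_i \sum_(j | i != j) F (i, j).
Proof. by rewrite pair_big_dep /=; apply: eq_big => -[]. Qed.

Let count_row (i : 'I_n) : \sum_(j | i != j) (1 : R) = n%:R - 1.
Proof.
rewrite sumr_const (eq_card (B := predC1 i)); last first.
  by move=> j; rewrite !inE eq_sym.
have := cardC1 i; rewrite card_ord => ->.
by case: n i => [[]//|m] _; rewrite -natr1 addrK.
Qed.

Let count_fst (i : 'I_n) : \sum_(q | off q) (q.1 == i)%:R = n%:R - 1 :> R.
Proof.
rewrite sum_off (bigD1 i)//= -[RHS]addr0; congr (_ + _).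
  by rewrite -(count_row i); apply: eq_bigr => j _; rewrite eqxx.
by rewrite big1// => k ki; rewrite big1// => l _; rewrite (negbTE ki).
Qed.

Let count_snd (i : 'I_n) : \sum_(q | off q) (q.2 == i)%:R = n%:R - 1 :> R.
Proof.
rewrite -(count_fst i) !sum_off (exchange_big_dep predT)//=; apply: eq_bigr => l _.
by apply: eq_bigl => k; rewrite eq_sym.
Qed.

Let count_eq (p : 'I_n * 'I_n) : off p -> \sum_(q | off q) (q == p)%:R = 1 :> R.
Proof.
move=> op; rewrite (bigD1 p)//= eqxx -[RHS]addr0; congr (_ + _).
by rewrite big1// => q /andP[_ /negbTE ->].
Qed.

Let count_off : \sum_(p | off p) (1 : R) = n%:R * (n%:R - 1).
Proof.
rewrite sum_off; under eq_bigr do rewrite count_row.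
by rewrite sumr_const card_ord -[LHS]mulr_natl.
Qed.

Let c : R := (n%:R * (n%:R - 1))^-1.

Let U w := c * \sum_(i < n) \sum_(j < n | i != j) K (X i w) (X j w).

Let ustatE w : U w = c * \sum_(p | off p) KX p w.
Proof. by rewrite /U sum_off. Qed.

Let ustat_sqrE w :
  U w ^+ 2 = c ^+ 2 * \sum_(p | off p) \sum_(q | off q) KX p w * KX q w.
Proof.
rewrite ustatE exprMn; congr (_ * _); rewrite expr2 big_distrl/=.
by apply: eq_bigr => p _; rewrite big_distrr.
Qed.

Lemma measurable_ustat : measurable_fun setT U.
Proof.
rewrite (_ : U = fun w => c * \sum_p (if off p then KX p w else 0)).
  by apply: measurable_funM => //; apply: measurable_sum => p; case: (off p).
by apply/funext => w; rewrite ustatE big_mkcond.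
Qed.

Lemma integrable_ustat_sqr :
  Pr.-integrable setT (EFin \o (fun w => U w ^+ 2)).
Proof.
under eq_fun do rewrite ustat_sqrE.
apply: integrable_mulr_EFin; apply: (integrable_sum_EFin measurableT) => p op.
by apply: (integrable_sum_EFin measurableT) => q oq; exact: KXM.
Qed.

Lemma integrable_ustat : Pr.-integrable setT (EFin \o U).
Proof. exact: integrable_sqr_EFin measurable_ustat integrable_ustat_sqr. Qed.

Context (n_ge2 : (2 <= n)%N).

Let n_gt0 : 0 < n%:R :> R. Proof. by rewrite ltr0n (leq_trans _ n_ge2). Qed.

Let n1_gt0 : 0 < n%:R - 1 :> R. Proof. by rewrite subr_gt0 ltr1n. Qed.

Let cK : c * (n%:R * (n%:R - 1)) = 1.
Proof. by rewrite mulVf// mulf_neq0// gt_eqF. Qed.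

Lemma Rintegral_ustat : \int[Pr]_w U w = m1.
Proof.
under eq_Rintegral do rewrite ustatE.
rewrite RintegralZl//; last by apply: (integrable_sum_EFin measurableT) => p /KX1[].
rewrite (Rintegral_sum measurableT); last by move=> p /KX1[].
rewrite (eq_bigr (fun=> m1 * 1)) => [|p /KX1[_ ->]]; last by rewrite mulr1.
by rewrite -big_distrr/= count_off mulrCA cK mulr1.
Qed.

(** The second moment is a double sum over off-diagonal pairs; it is bounded row by row, one row for
    each first pair [p], with [cov_le]. *)
Lemma Rintegral_ustat_var : \int[Pr]_w ((U w - m1) ^+ 2) <=
  4 * S / n%:R + 2 / (n%:R * (n%:R - 1)) * V.
Proof.
have -> : \int[Pr]_w ((U w - m1) ^+ 2) =
    \int[Pr]_w (U w ^+ 2) - m1 ^+ 2.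
  transitivity (\int[Pr]_w (U w ^+ 2 - (2 * m1 * U w - m1 ^+ 2))).
    by apply: eq_Rintegral => w _; ring.
  rewrite RintegralB//; first last.
  - apply: integrableB_EFin; last exact: integrable_cst_EFin.
    exact/integrable_mulr_EFin/integrable_ustat.
  - exact: integrable_ustat_sqr.
  rewrite RintegralB//; first last.
  - exact: integrable_cst_EFin.
  - exact/integrable_mulr_EFin/integrable_ustat.
  rewrite RintegralZl//; last exact: integrable_ustat.
  by rewrite Rintegral_ustat Rintegral_cst_probability; ring.
under eq_Rintegral do rewrite ustat_sqrE.
rewrite RintegralZl//; last first.
  apply: (integrable_sum_EFin measurableT) => p op.
  by apply: (integrable_sum_EFin measurableT) => q oq; exact: KXM.
rewrite (Rintegral_sum measurableT); last first.
  by move=> p op; apply: (integrable_sum_EFin measurableT) => q oq; exact: KXM.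
(* For fixed [p], each of the four index coincidences holds for [n - 1] pairs [q], while [q] equals
   [p] or its reversal once each. *)
have row p : off p -> \int[Pr]_w (\sum_(q | off q) KX p w * KX q w) <=
    n%:R * (n%:R - 1) * m1 ^+ 2 + (S * (4 * (n%:R - 1)) + V * 2).
  move=> op; rewrite (Rintegral_sum measurableT); last by move=> q oq; exact: KXM.
  have op' : off (p.2, p.1) by rewrite /off eq_sym.
  apply: (@le_trans _ _ (\sum_(q | off q) (m1 ^+ 2 * 1 +
      (S * ((q.1 == p.1)%:R + (q.1 == p.2)%:R + (q.2 == p.1)%:R + (q.2 == p.2)%:R) +
       V * ((q == p)%:R + (q == (p.2, p.1))%:R))))).
    apply: ler_sum => -[k l] oq; rewrite mulr1 -lerBlDl.
    by case: p op {op'} => i j op; exact: cov_le.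
  rewrite big_split/= -big_distrr/= count_off mulrC lerD2l.
  rewrite big_split/= -!big_distrr/= !big_split/= !count_fst !count_snd.
  by rewrite !count_eq// le_eqVlt; apply/orP; left; apply/eqP; ring.
(* There are [n (n - 1)] rows, so after multiplication by [c ^ 2] the [m1 ^ 2] terms cancel
   exactly. *)
apply: (@le_trans _ _ (c ^+ 2 * (\sum_(p | off p) (n%:R * (n%:R - 1) * m1 ^+ 2 +
    (S * (4 * (n%:R - 1)) + V * 2)) * 1) - m1 ^+ 2)).
  rewrite lerD2r ler_wpM2l ?sqr_ge0//; apply: ler_sum => p op.
  by rewrite mulr1 row.
rewrite -big_distrr/= count_off le_eqVlt; apply/orP; left; apply/eqP.
rewrite /c; field; by rewrite !gt_eqF.
Qed.

End ustat_moments.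

(** * Bochner integrals *)

Section bochner_integral.
Context d (T : measurableType d) (R : realType) (mu : probability T R).
Context (D : set T) (mD : measurable D).
Context (V : lmodType R) (ip : V -> V -> R) (hip : inner_product ip).

Local Notation "`[ u ]" := (ipnorm ip u) (format "`[ u ]").

(** The range over [D] is separable, and measurability is tested on distances to fixed vectors
    because [V] is a bare module. The points [c m] need not lie in the range of [f]. *)
Definition strongly_measurable (f : T -> V) :=
  (exists c : nat -> V, forall x, D x -> forall e : R, 0 < e ->
     exists m, `[f x - c m] < e) /\
  (forall v, measurable_fun D (fun x => `[f x - v])).

Lemma measurable_ipnorm f : strongly_measurable f ->
  measurable_fun D (fun x => `[f x]).
Proof. by case=> _ /(_ 0); under eq_fun do rewrite subr0. Qed.

(** Polarisation expresses the inner product through measurable norms. *)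
Lemma measurable_ip f w : strongly_measurable f ->
  measurable_fun D (fun x => ip (f x) w).
Proof.
move=> fm; have fm0 := measurable_ipnorm fm; case: fm => _ fm.
rewrite (_ : (fun x => _) =
  fun x => 2^-1 * (`[f x] ^+ 2 + `[w] ^+ 2 - `[f x - w] ^+ 2)).
  apply: measurable_funM => //; apply: measurable_funB; last exact: measurable_funX.
  by apply: measurable_funD => //; exact: measurable_funX.
apply/funext => x; rewrite !(sqr_ipnorm hip) (ipBl hip) !(ipBr hip) (ipC hip w).
by field.
Qed.

Lemma integrable_ip f w : strongly_measurable f ->
  mu.-integrable D (EFin \o (fun x => `[f x])) ->
  mu.-integrable D (EFin \o (fun x => ip (f x) w)).
Proof.
move=> fm fi; have wi : mu.-integrable D (EFin \o (fun x => `[w] * `[f x])).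
  by apply: eq_integrable (integrableZl mD `[w] fi).
apply: le_integrable wi => //; first exact/measurable_EFinP/measurable_ip.
move=> x _ /=; rewrite lee_fin [leRHS]ger0_norm ?mulr_ge0 ?(ipnorm_ge0 ip)//.
by rewrite mulrC (ip_cauchy_schwarz hip).
Qed.

Lemma integrable_indic_EFin A : measurable A ->
  mu.-integrable D (EFin \o (\1_A : T -> R)).
Proof.
by move=> mA; apply: integrableS (integrable_indic mu mA).
Qed.

Lemma ip_vs_fun (s : vsimple (V := V) mu) w x :
  ip (vs_fun s x) w = \sum_i ip (vs_val (v := s) i) w * \1_(vs_set (v := s) i) x.
Proof.
rewrite /vs_fun (ip_suml hip); apply: eq_bigr => i _.
by rewrite (ipZl hip) mulrC.
Qed.

Let integrable_vs_term (s : vsimple (V := V) mu) w i : mu.-integrable D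
  (EFin \o (fun x => ip (vs_val (v := s) i) w * \1_(vs_set (v := s) i) x)).
Proof.
apply: eq_integrable (integrableZl mD (ip (vs_val (v := s) i) w)
  (integrable_indic_EFin (@vs_measurable _ _ _ _ _ s i))) => //.
Qed.

Lemma integrable_vs_ip (s : vsimple mu) w :
  mu.-integrable D (EFin \o (fun x => ip (vs_fun s x) w)).
Proof.
under eq_fun do rewrite ip_vs_fun.
by apply: (integrable_sum_EFin mD) => i _; exact: integrable_vs_term.
Qed.

Lemma ip_vs_integral (s : vsimple mu) w :
  ip (vs_integral D s) w = \int[mu]_(x in D) ip (vs_fun s x) w.
Proof.
under eq_Rintegral do rewrite ip_vs_fun.
rewrite (Rintegral_sum mD); last by move=> i _; exact: integrable_vs_term.
rewrite /vs_integral (ip_suml hip); apply: eq_bigr => i _.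
have ms := @vs_measurable _ _ _ _ _ s i.
rewrite (ipZl hip) RintegralZl//; last exact: integrable_indic_EFin.
by rewrite mulrC /Rintegral integral_indic.
Qed.

Lemma ip_vs_integral_dist (f : T -> V) (s : vsimple mu) w :
  mu.-integrable D (EFin \o (fun x => ip (f x) w)) ->
  mu.-integrable D (EFin \o (fun x => `[f x - vs_fun s x])) ->
  `|\int[mu]_(x in D) ip (f x) w - ip (vs_integral D s) w| <=
  `[w] * \int[mu]_(x in D) `[f x - vs_fun s x].
Proof.
move=> fi fsi; have si := integrable_vs_ip s w.
rewrite ip_vs_integral -RintegralB// -RintegralZl//.
have bi : mu.-integrable D (EFin \o (fun x => ip (f x) w - ip (vs_fun s x) w)).
  by apply: eq_integrable (integrableB mD fi si).
rewrite (le_trans (le_normr_Rintegral mD bi))// le_Rintegral//.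
- exact: integrable_norm.
- by apply: eq_integrable (integrableZl mD `[w] fsi).
by move=> x _; rewrite -(ipBl hip) mulrC (ip_cauchy_schwarz hip).
Qed.

Let integrable_dist (f g : T -> V) : measurable_fun D (fun x => `[f x - g x]) ->
  (\int[mu]_(x in D) (`[f x - g x])%:E < +oo)%E ->
  mu.-integrable D (EFin \o (fun x => `[f x - g x])).
Proof.
move=> mfg fgi; apply/integrableP; split; first exact/measurable_EFinP.
by under eq_integral => x _ do rewrite /= ger0_norm ?(ipnorm_ge0 ip)//.
Qed.

(** The integrals are extended reals, so convergence to 0 yields finiteness, hence integrability,
    only from some rank on. *)
Let near_integrable (f : T -> V) (s : nat -> vsimple mu) :
  (forall n, measurable_fun D (fun x => `[f x - vs_fun (s n) x])) ->
  (fun n => \int[mu]_(x in D) (`[f x - vs_fun (s n) x])%:E)%E @ \oo --> 0%E ->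
  forall e : R, 0 < e -> exists N, forall n, (N <= n)%N ->
    mu.-integrable D (EFin \o (fun x => `[f x - vs_fun (s n) x])) /\
    \int[mu]_(x in D) `[f x - vs_fun (s n) x] < e.
Proof.
move=> mfs /fine_cvgP[[N1 _ fin1] /cvgrPdist_lt lim0] e e0.
have [N2 _ lt2] := lim0 e e0; exists (maxn N1 N2) => n.
rewrite geq_max => /andP[/fin1 /= fn /lt2 /= ln]; split.
  by apply: integrable_dist => //; rewrite ltey_eq fn.
by move: ln; rewrite sub0r normrN; apply: le_lt_trans; rewrite ler_norm.
Qed.

(** The identity holds for simple functions by linearity, and both sides pass to the limit. All
    later use of Bochner integrals goes through it, whichever approximating sequence was chosen. *)
Lemma is_bochner_ip f v w : is_bochner ip mu D f v ->
  mu.-integrable D (EFin \o (fun x => ip (f x) w)) ->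
  ip v w = \int[mu]_(x in D) ip (f x) w.
Proof.
move=> [s [mfs fs0 sv]] fi; apply/esym/eqP; rewrite -subr_eq0 -normr_le0.
apply/ler_addgt0Pr => e e0; rewrite add0r.
(* Adding 1 keeps the divisor positive even for [w = 0]. *)
have w0 : 0 < `[w] + 1 by rewrite ltr_wpDl// ipnorm_ge0.
have e2 : 0 < e / 2 / (`[w] + 1) by rewrite !divr_gt0.
have [N1 hN1] := near_integrable mfs fs0 e2.
have /cvgrPdist_lt/(_ _ (divr_gt0 e0 (ltr0Sn _ 1))) [N2 _ hN2] :=
  ipnorm_cvg_ip hip (w := w) sv.
have [i1 l1] := hN1 _ (leq_maxl N1 N2); have l2 := hN2 _ (leq_maxr N1 N2).
set n := maxn N1 N2 in i1 l1 l2.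
rewrite -(subrKA (ip (vs_integral D (s n)) w)) (le_trans (ler_normD _ _))//.
rewrite (splitr e) lerD//; last by rewrite distrC ltW.
rewrite (le_trans (ip_vs_integral_dist fi i1))//.
apply: (@le_trans _ _ ((`[w] + 1) * \int[mu]_(x in D) `[f x - vs_fun (s n) x])).
  rewrite ler_wpM2r ?lerDl//; apply: Rintegral_ge0 => x _; exact: ipnorm_ge0.
by rewrite mulrC -ler_pdivlMr// ltW.
Qed.

Lemma bochner_exists_of_approx (f : T -> V) (s : nat -> vsimple mu) :
  ip_complete ip ->
  strongly_measurable f -> mu.-integrable D (EFin \o (fun x => `[f x])) ->
  (forall n, measurable_fun D (fun x => `[f x - vs_fun (s n) x])) ->
  (fun n => \int[mu]_(x in D) (`[f x - vs_fun (s n) x])%:E)%E @ \oo --> 0%E ->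
  exists v, is_bochner ip mu D f v.
Proof.
move=> cpl fm fi mfs fs0; have [|v sv] := cpl (fun n => vs_integral D (s n)).
  move=> e e0; have [N hN] := near_integrable mfs fs0 (divr_gt0 e0 (ltr0Sn _ 1)).
  exists N => n m /hN[ni nlt] /hN[mi mlt].
  (* The difference [w] of two integrals is tested against itself: [|w| ^ 2] is at most [|w|] times
     the sum of the two [L^1] errors, and one factor [|w|] cancels. *)
  set w := _ - _; have [->//|w0] := eqVneq `[w] 0.
  have {}w0 : 0 < `[w] by rewrite lt_def w0 ipnorm_ge0.
  rewrite -(ltr_pM2l w0) -expr2 (sqr_ipnorm hip) {1}/w (ipBl hip).
  have fwi := integrable_ip w fm fi.
  have := ip_vs_integral_dist fwi ni; have := ip_vs_integral_dist fwi mi.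
  rewrite !ler_norml => /andP[_ h1] /andP[h2 _].
  have : `[w] * (\int[mu]_(x in D) `[f x - vs_fun (s n) x] +
      \int[mu]_(x in D) `[f x - vs_fun (s m) x]) < `[w] * e.
    by rewrite ltr_pM2l// (splitr e) ltrD.
  by rewrite mulrDr; lra.
by exists v, s.
Qed.

Section nearest_point_approximation.
Context (f : T -> V) (fm : strongly_measurable f) (c : nat -> V).

Let dist j x := `[f x - c j].

(* [nearest N m] is where [c m] is the first point of [c 0, ..., c N] that is
   nearest to [f x]. *)
Let nearest (N m : nat) : set T := \bigcap_(j in [set j | (j <= N)%N])
  (D `&` [set x |
    if (j < m)%N then dist m x < dist j x else dist m x <= dist j x]).

Let measurable_dist j : measurable_fun D (EFin \o dist j).
Proof. by case: fm => _ fm2; apply/measurable_EFinP/fm2. Qed.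

Let measurable_nearest N m : measurable (nearest N m).
Proof.
apply: bigcap_measurableType => j _; case: (j < m)%N.
  have := measurable_lte mD (measurable_dist m) (measurable_dist j).
  by under eq_set do rewrite /= lte_fin.
have := measurable_lee mD (measurable_dist m) (measurable_dist j).
by under eq_set do rewrite /= lee_fin.
Qed.

Let nearest_finite N m : (mu (nearest N m) < +oo)%E.
Proof. by rewrite ltey_eq fin_num_measure. Qed.

Definition nearest_simple N : vsimple (V := V) mu :=
  @VSimple _ _ _ _ mu N.+1 (fun i => nearest N i) (fun i => c i)
    (fun i => measurable_nearest N i) (fun i => nearest_finite N i).

(** Strictness against earlier points breaks ties, so for given [N] the sets [nearest N m] partition
    [D] and the simple function takes exactly one of the values [c m]. *)
Let nearest_ex N x : D x -> exists2 m : 'I_N.+1, nearest N m x &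
  forall j : 'I_N.+1, nearest N j x -> j = m.
Proof.
move=> Dx.
pose p (m : nat) := (m <= N)%N && [forall j : 'I_N.+1, dist m x <= dist j x].
have [m0 _ hm0] := @arg_minP _ _ _ (@ord0 N) xpredT (fun j => dist j x) isT.
have pm0 : exists m, p m.
  by exists m0; rewrite /p -ltnS ltn_ord; apply/forallP => j; exact: hm0.
case: (ex_minnP pm0) => m /andP[mN /forallP mmin] mfirst.
have mN1 : (m < N.+1)%N by rewrite ltnS.
exists (Ordinal mN1) => /= [j jN|j hj].
  have jN1 : (j < N.+1)%N by rewrite ltnS.
  split => //=; case: ifPn => jm; last exact: (mmin (Ordinal jN1)).
  rewrite ltNge; apply/negP => ji; move: jm; rewrite ltnNge mfirst//.
  by rewrite /p jN; apply/forallP => k; exact: le_trans ji (mmin k).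
have {hj}hj k : (k <= N)%N -> _ := fun kN => (hj k kN).2.
apply/val_inj => /=; apply/eqP; rewrite eqn_leq; apply/andP; split.
  rewrite leqNgt; apply/negP => mj; have := hj m mN; rewrite /= mj => lt.
  by have := mmin j; rewrite leNgt lt.
apply: mfirst; rewrite /p -ltnS ltn_ord; apply/forallP => k /=.
by have := hj k; rewrite -ltnS ltn_ord => /(_ isT) /=; case: ifP => // _ /ltW.
Qed.

Lemma nearest_simpleE N x : D x -> exists2 m : 'I_N.+1,
  vs_fun (nearest_simple N) x = c m &
  forall j, (j <= N)%N -> `[f x - c m] <= `[f x - c j].
Proof.
move=> Dx; have [m hm um] := nearest_ex N Dx; exists m => [|j jN].
  rewrite /vs_fun (bigD1 m)//= indicE mem_set// scale1r big1 ?addr0// => j jm.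
  rewrite indicE memNset ?scale0r// => /um E; by rewrite E eqxx in jm.
by have [_ /=] := hm j jN; case: ifP => // _ /ltW.
Qed.

Lemma measurable_nearest_simple N :
  measurable_fun D (fun x => `[f x - vs_fun (nearest_simple N) x]).
Proof.
apply: (@eq_measurable_fun _ _ _ _ D
    (fun x => \sum_(i < N.+1) \1_(nearest N i) x * dist i x)).
  move=> x; rewrite inE => Dx; have [m hm um] := nearest_ex N Dx.
  have -> : vs_fun (nearest_simple N) x = c m.
    rewrite /vs_fun (bigD1 m)//= indicE mem_set// scale1r big1 ?addr0// => j jm.
    rewrite indicE memNset ?scale0r// => /um E; by rewrite E eqxx in jm.
  rewrite (bigD1 m)//= indicE mem_set// mul1r big1 ?addr0// => j jm.
  rewrite indicE memNset ?mul0r// => /um E; by rewrite E eqxx in jm.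
apply: measurable_sum => i; apply: measurable_funM; first exact: measurable_indic.
by case: fm => _ fm2; exact: fm2.
Qed.

(** Dominated convergence: the error at [x] is at most the distance to any [c m] with [m <= n],
    hence tends to 0. Since [c 0 = 0] is always a candidate, it never exceeds [|f x|]. *)
Lemma nearest_simple_cvg :
  (forall x, D x -> forall e : R, 0 < e -> exists m, `[f x - c m] < e) ->
  mu.-integrable D (EFin \o (fun x => `[f x])) -> c 0%N = 0 ->
  (fun n => \int[mu]_(x in D) (`[f x - vs_fun (nearest_simple n) x])%:E)%E
    @ \oo --> 0%E.
Proof.
move=> dense fi c0.
pose g n x := (`[f x - vs_fun (nearest_simple n) x])%:E.
have mg n : measurable_fun D (g n).
  by apply/measurable_EFinP; exact: measurable_nearest_simple.
have [|//||_ _] := @dominated_convergence _ _ _ mu D mD g (cst 0%E)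
  (fun x => (`[f x])%:E) mg (measurable_cst _); last by rewrite integral0.
  apply: aeW => x Dx; apply: cvg_EFin; first exact: nearW.
  apply/cvgrPdist_lt => e e0; have [m hm] := dense x Dx e e0.
  exists m => // n /= mn; rewrite sub0r normrN ger0_norm ?ipnorm_ge0//.
  have [k -> hk] := nearest_simpleE n Dx.
  exact: le_lt_trans (hk m mn) hm.
apply: aeW => x n Dx /=; rewrite ger0_norm ?ipnorm_ge0// lee_fin.
have [k -> hk] := nearest_simpleE n Dx.
by rewrite (le_trans (hk 0%N _))// c0 subr0.
Qed.

End nearest_point_approximation.

Lemma bochner_exists (f : T -> V) : ip_complete ip ->
  strongly_measurable f -> mu.-integrable D (EFin \o (fun x => `[f x])) ->
  exists v, is_bochner ip mu D f v.
Proof.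
move=> cpl /[dup] fm [[c dense] _] fi.
(* The vector 0 is put in front of the dense sequence to provide the dominating function. *)
pose c' n := if n is m.+1 then c m else 0.
apply: (bochner_exists_of_approx cpl fm fi (s := nearest_simple fm c')).
  by move=> n; exact: measurable_nearest_simple.
apply: nearest_simple_cvg => // x Dx e e0.
by have [m hm] := dense x Dx e e0; exists m.+1.
Qed.

Lemma bochnerP (f : T -> V) : ip_complete ip ->
  strongly_measurable f -> mu.-integrable D (EFin \o (fun x => `[f x])) ->
  is_bochner ip mu D f (bochner ip mu D f).
Proof.
move=> cpl fm fi; have bex := bochner_exists cpl fm fi.
exact: (xgetPex 0 bex).
Qed.

Lemma ip_bochner (f : T -> V) w : ip_complete ip ->
  strongly_measurable f -> mu.-integrable D (EFin \o (fun x => `[f x])) ->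
  ip (bochner ip mu D f) w = \int[mu]_(x in D) ip (f x) w.
Proof.
move=> cpl fm fi; apply: is_bochner_ip; first exact: bochnerP.
exact: integrable_ip.
Qed.

End bochner_integral.

(** * Orthonormal bases *)

Section orthonormal_systems.
Context (R : realType) (V : lmodType R) (ip : V -> V -> R).
Context (hip : inner_product ip).

Local Notation "`[ u ]" := (ipnorm ip u) (format "`[ u ]").

(** Zorn's lemma gives a maximal orthonormal set; a nonzero vector orthogonal to it could be
    normalised and added. *)
Lemma orthonormal_basis_exists : exists E, orthonormal_basis ip E.
Proof.
pose orthonormal (E : set V) := (forall e, E e -> ip e e = 1) /\
  (forall e f, E e -> E f -> e <> f -> ip e f = 0).
have [|E [[E1 E0] Emax]] := @Zorn_bigcup V orthonormal.
  move=> F FP Ftot; split => [e [A FA Ae]|e f [A FA Ae] [B FB Bf] ef].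
    by have [+ _] := FP _ FA; apply.
  have [AB|BA] := Ftot _ _ FA FB.
    by have [_ +] := FP _ FB; apply => //; exact: AB.
  by have [_ +] := FP _ FA; apply => //; exact: BA.
exists E; split => // v vE; apply: contrapT => v0.
have nv0 : `[v] != 0 by apply/eqP => /(ipnorm0_eq0 hip).
pose u := `[v]^-1 *: v.
have u1 : ip u u = 1.
  by rewrite /u (ipZl hip) (ipZr hip) -(sqr_ipnorm hip); field.
have uE e : E e -> ip e u = 0 by move=> Ee; rewrite /u (ipZr hip) vE// mulr0.
have notEu : ~ E u by move=> /uE; rewrite u1 => /eqP; rewrite oner_eq0.
apply: (Emax (E `|` [set u])).
  rewrite properEneq; split; last exact: subsetUl.
  apply/eqP => EU; apply: notEu; rewrite EU; by right.
split=> [e [/E1//|->//]|e f [Ee|->] [Ef|->]//]; first exact: E0.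
- by move=> _; exact: uE.
- by move=> _; rewrite (ipC hip); exact: uE.
Qed.

Lemma onbP : orthonormal_basis ip (onb ip).
Proof. exact: (xgetPex set0 orthonormal_basis_exists). Qed.

Definition oproj (F : seq V) (v : V) : V := \sum_(e <- F) ip e v *: e.

Lemma oprojB F u v : oproj F (u - v) = oproj F u - oproj F v.
Proof.
by rewrite /oproj -sumrB; apply: eq_bigr => e _; rewrite (ipBr hip) scalerBl.
Qed.

Lemma ip_oproj F u v : ip (oproj F u) v = \sum_(e <- F) ip e u * ip e v.
Proof.
by rewrite /oproj (ip_suml hip); apply: eq_bigr => e _; rewrite (ipZl hip).
Qed.

Context (E : set V) (E_onb : orthonormal_basis ip E).

Definition onseq (F : seq V) := uniq F /\ forall e, e \in F -> E e.

Lemma ip_oproj_mem F e v : onseq F -> e \in F -> ip e (oproj F v) = ip e v.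
Proof.
move=> [uF FE] eF; rewrite (ipC hip) ip_oproj (bigD1_seq e)//=.
case: E_onb => E1 E0 _; rewrite (E1 e) ?mulr1; last exact: FE.
rewrite big_seq_cond big1 ?addr0// => f /andP[fF fe].
by rewrite (E0 f e) ?mulr0//; [exact: FE|exact: FE|exact/eqP].
Qed.

(** The vector [oproj F v] is a combination of members of [G], and each of these is fixed by the
    projection on [G]. *)
Lemma oproj_idem F G v : onseq G -> {subset F <= G} ->
  oproj G (oproj F v) = oproj F v.
Proof.
move=> oG FG; suff h (w : V) : ip (oproj G (oproj F v) - oproj F v) w = 0.
  by apply/eqP; rewrite -subr_eq0; apply/eqP/(ip_eq0 hip)/h.
rewrite (ipBl hip) ip_oproj [ip (oproj F v) w]ip_oproj.
apply/eqP; rewrite subr_eq0; apply/eqP.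
under eq_bigr do rewrite (ipC hip) ip_oproj big_distrl/=.
rewrite exchange_big/= big_seq [RHS]big_seq; apply: eq_bigr => f fF.
under eq_bigr do rewrite -mulrA.
rewrite -big_distrr/=; congr (_ * _).
have := ip_oproj_mem w oG (FG _ fF); rewrite (ipC hip) ip_oproj => <-.
by apply: eq_bigr => e _; rewrite mulrC (ipC hip f).
Qed.

Lemma ip_sub_oproj F u v : onseq F -> ip (v - oproj F v) (oproj F u) = 0.
Proof.
move=> oF; rewrite (ipC hip) ip_oproj big_seq big1// => e eF.
by rewrite (ipBr hip) ip_oproj_mem// subrr mulr0.
Qed.

Lemma sqr_ipnorm_oproj F v : onseq F ->
  `[v] ^+ 2 = `[v - oproj F v] ^+ 2 + `[oproj F v] ^+ 2.
Proof.
move=> oF; have ab := ip_sub_oproj v v oF; rewrite !(sqr_ipnorm hip).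
rewrite [in LHS](_ : v = (v - oproj F v) + oproj F v); last by rewrite subrK.
move: ab; set a := v - _; set b := oproj F v => ab.
rewrite (ipDl hip a b) (ipDr hip a b a) (ipDr hip a b b).
by rewrite ab (ipC hip b) ab addr0 add0r.
Qed.

Lemma ler_ipnorm_sub_oproj F v : onseq F -> `[v - oproj F v] <= `[v].
Proof.
move=> oF; rewrite -(ler_pXn2r (ltn0Sn 1)) ?nnegrE ?ipnorm_ge0//.
by rewrite [leRHS](sqr_ipnorm_oproj v oF) lerDl sqr_ge0.
Qed.

Lemma ler_ipnorm_oproj F v : onseq F -> `[oproj F v] <= `[v].
Proof.
move=> oF; rewrite -(ler_pXn2r (ltn0Sn 1)) ?nnegrE ?ipnorm_ge0//.
by rewrite [leRHS](sqr_ipnorm_oproj v oF) lerDr sqr_ge0.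
Qed.

(** Pythagoras for the residual of [F], whose projection on the span of [G] is the difference of the
    two projections. *)
Let residual_sub F G v : onseq F -> onseq G -> {subset F <= G} ->
  `[v - oproj F v] ^+ 2 =
  `[v - oproj G v] ^+ 2 + `[oproj G v - oproj F v] ^+ 2.
Proof.
move=> oF oG FG; rewrite (sqr_ipnorm_oproj (v - oproj F v) oG) oprojB.
by rewrite oproj_idem// -addrA opprB addKr.
Qed.

Lemma ler_residual F G v : onseq F -> onseq G -> {subset F <= G} ->
  `[v - oproj G v] <= `[v - oproj F v].
Proof.
move=> oF oG FG; rewrite -(ler_pXn2r (ltn0Sn 1)) ?nnegrE ?ipnorm_ge0//.
by rewrite [leRHS](residual_sub v oF oG FG) lerDl sqr_ge0.
Qed.

Lemma onseq_cat F G : onseq F -> onseq G -> onseq (undup (F ++ G)).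
Proof.
move=> [_ FE] [_ GE]; split; first exact: undup_uniq.
by move=> e; rewrite mem_undup mem_cat => /orP[/FE|/GE].
Qed.

(* Finite sets along which the residual tends to its infimum have Cauchy
   projections; their limit [w] is such that [v - w] is orthogonal to the basis. *)
Lemma oproj_dense v (e : R) : ip_complete ip -> 0 < e ->
  exists2 F, onseq F & `[v - oproj F v] < e.
Proof.
move=> cpl e0; pose A := [set `[v - oproj F v] ^+ 2 | F in onseq].
have on0 : onseq [::] by [].
have hA : has_inf A.
  split; first by exists (`[v - oproj [::] v] ^+ 2), [::].
  by exists 0 => _ [F _ <-]; exact: sqr_ge0.
have lbA F : onseq F -> inf A <= `[v - oproj F v] ^+ 2.
  by move=> oF; apply: ge_inf; [case: hA|exists F].
have /choice[F hF] n : exists F, onseq F /\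
    `[v - oproj F v] ^+ 2 < inf A + n.+1%:R^-1.
  have n0 : 0 < n.+1%:R^-1 :> R by rewrite invr_gt0.
  by have [_ [F oF <-] ltF] := inf_adherent n0 hA; exists F.
(* Cumulative unions make the minimising sets increasing, which the comparison of residuals
   requires. *)
pose G := fix G n := if n is m.+1 then undup (G m ++ F n) else F 0%N.
have oF n : onseq (F n) by case: (hF n).
have oG n : onseq (G n) by elim: n => [|n ih]; [exact: oF|exact: onseq_cat].
have FG n : {subset F n <= G n}.
  by case: n => [|n] x //; rewrite mem_undup mem_cat orbC => ->.
have GG n m : (n <= m)%N -> {subset G n <= G m}.
  move=> /subnK <-; elim: (m - n)%N => [//|k ih] x /ih.
  by rewrite addSn /= mem_undup mem_cat => ->.
have ltG n : `[v - oproj (G n) v] ^+ 2 < inf A + n.+1%:R^-1.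
  have [_ ltF] := hF n.
  apply: le_lt_trans ltF; rewrite ler_pXn2r ?nnegrE ?ipnorm_ge0//.
  exact: ler_residual.
have dG n m : (n <= m)%N -> `[oproj (G m) v - oproj (G n) v] ^+ 2 < n.+1%:R^-1.
  move=> nm; rewrite -(ltrD2l (inf A)); apply: le_lt_trans (ltG n).
  by rewrite (residual_sub v (oG n) (oG m) (GG _ _ nm)) lerD2r lbA.
have small (r : R) : 0 < r -> exists N, forall n, (N <= n)%N -> n.+1%:R^-1 < r.
  move=> r0; have := @near_infty_natSinv_lt R (PosNum r0).
  by move=> [N _ hN]; exists N => n /hN.
have [|w Gw] := cpl (fun n => oproj (G n) v).
  move=> r r0; have [N hN] := small _ (exprn_gt0 2 r0); exists N.
  suff h n m : (N <= n)%N -> (n <= m)%N -> `[oproj (G m) v - oproj (G n) v] < r.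
    move=> n m Nn Nm; have [nm|/ltnW mn] := leqP n m; last exact: h.
    by rewrite (ipnormBC hip); exact: h.
  move=> Nn nm; rewrite -(ltr_pXn2r (ltn0Sn 1)) ?nnegrE ?ipnorm_ge0 1?ltW//.
  exact: lt_trans (dG _ _ nm) (hN _ Nn).
(* Adjoining [f] to [G n] lowers the squared residual by at least [<f, v - oproj (G n) v> ^ 2], yet
   it cannot fall below the infimum, so the drop is less than [1 / (n + 1)]. *)
have gap n f : E f -> `|ip f (v - oproj (G n) v)| ^+ 2 < n.+1%:R^-1.
  move=> Ef; have of' : onseq [:: f] by split=> // x; rewrite inE => /eqP->.
  have oG' := onseq_cat (oG n) of'; set G' := undup _ in oG'.
  have GG' : {subset G n <= G'}.
    by move=> x; rewrite mem_undup mem_cat => ->.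
  have fG' : f \in G' by rewrite mem_undup mem_cat mem_head orbT.
  set u := v - _; rewrite -(ip_oproj_mem u oG' fG').
  apply: (@le_lt_trans _ _ (`[oproj G' u] ^+ 2)).
    rewrite ler_pXn2r ?nnegrE ?ipnorm_ge0// (le_trans (ip_cauchy_schwarz hip _ _))//.
    by case: E_onb => E1 _ _; rewrite /ipnorm E1// sqrtr1 mul1r.
  have := sqr_ipnorm_oproj u oG'; rewrite {2}/u oprojB (oproj_idem _ oG' GG').
  rewrite /u -addrA opprB addKr => h.
  rewrite -(ltrD2l (inf A)); apply: le_lt_trans (ltG n).
  by rewrite h lerD2r lbA.
have vw : v - w = 0.
  case: (E_onb) => E1 _; apply => f Ef; apply/eqP; rewrite -normr_le0.
  apply/ler_addgt0Pr => r r0; rewrite add0r.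
  have r2 : 0 < r / 2 by rewrite divr_gt0.
  have [N1 hN1] := small _ (exprn_gt0 2 r2).
  have /cvgrPdist_lt/(_ _ r2) [N2 _ hN2] := Gw.
  set n := maxn N1 N2; have /= := hN2 n (leq_maxr _ _).
  rewrite sub0r normrN ger0_norm ?ipnorm_ge0// => l2.
  have l1 : `|ip f (v - oproj (G n) v)| < r / 2.
    rewrite -(ltr_pXn2r (ltn0Sn 1)) ?nnegrE// ?ltW//.
    exact: lt_trans (gap _ _ Ef) (hN1 _ (leq_maxl _ _)).
  rewrite -(subrKA (oproj (G n) v)) (ipDr hip) (le_trans (ler_normD _ _))//.
  rewrite (splitr r) lerD//; first exact: ltW.
  rewrite (le_trans (ip_cauchy_schwarz hip _ _))//.
  by rewrite [`[f]]/ipnorm E1// sqrtr1 mul1r ltW.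
have /cvgrPdist_lt/(_ _ e0) [N _ hN] := Gw; exists (G N); first exact: oG.
move: vw => /eqP; rewrite subr_eq0 => /eqP {1}->.
have /= := hN N (leqnn _).
by rewrite sub0r normrN ger0_norm ?ipnorm_ge0// (ipnormBC hip).
Qed.

End orthonormal_systems.

(** * Strong measurability and kernel moments *)

Section strong_measurability.
Context d (T : measurableType d) (R : realType).
Context (D : set T) (mD : measurable D).
Context (V : lmodType R) (ip : V -> V -> R) (hip : inner_product ip).

Local Notation "`[ u ]" := (ipnorm ip u) (format "`[ u ]").

Lemma strongly_measurableZ (g : T -> R) (f : T -> V) : measurable_fun D g ->
  strongly_measurable D ip f -> strongly_measurable D ip (fun x => g x *: f x).
Proof.
move=> mg fm; have mf w := measurable_ip hip w fm.
have mf0 := measurable_ipnorm fm.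
case: (fm) => -[c dense] _; split.
  (* Rational multiples of the points [c m], enumerated through codes of pairs; numbers that code no
     pair give 0. *)
  pose c' n := if unpickle n is Some (q, m) then ratr (q : rat) *: c (m : nat) else 0.
  exists c' => x Dx e e0; have e2 : 0 < e / 2 by rewrite divr_gt0.
  have gx : 0 < `|g x| + 1 by rewrite ltr_wpDl.
  have [m hm] := dense x Dx _ (divr_gt0 e2 gx).
  have cm : 0 < `[c m] + 1 by rewrite ltr_wpDl// ipnorm_ge0.
  have e3 := divr_gt0 e2 cm.
  have /rat_in_itvoo[q] : g x - e / 2 / (`[c m] + 1) < g x + e / 2 / (`[c m] + 1).
    by rewrite ltrBlDr -addrA ltrDl addr_gt0.
  rewrite in_itv/= -ltr_distlC => hq.
  exists (pickle (q, m)); rewrite /c' pickleK.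
  rewrite (le_lt_trans (ler_ipnormB hip _ (g x *: c m) _))// (splitr e) ltrD//.
    rewrite -scalerBr (ipnormZ hip) (@le_lt_trans _ _ ((`|g x| + 1) * `[f x - c m]))//.
      by rewrite ler_wpM2r ?ipnorm_ge0// lerDl.
    by rewrite mulrC -ltr_pdivlMr.
  rewrite -scalerBl (ipnormZ hip) (@le_lt_trans _ _ (`|g x - ratr q| * (`[c m] + 1)))//.
    by rewrite ler_wpM2l// lerDl.
  by rewrite -ltr_pdivlMr.
(* Expanding the squared distance leaves only functions already known to be measurable. *)
move=> v; rewrite (_ : (fun x => _) = fun x =>
    Num.sqrt (g x ^+ 2 * `[f x] ^+ 2 - 2 * g x * ip (f x) v + `[v] ^+ 2)).
  apply: (measurableT_comp (continuous_measurable_fun (@sqrt_continuous R))).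
  apply: measurable_funD => //; apply: measurable_funB.
    by apply: measurable_funM; exact: measurable_funX.
  by apply: measurable_funM => //; exact: measurable_funM.
apply/funext => x; rewrite /ipnorm; congr Num.sqrt.
rewrite -!/(ipnorm _ _) !(sqr_ipnorm hip).
rewrite (ipBl hip) !(ipBr hip) !(ipZl hip) !(ipZr hip) (ipC hip v); ring.
Qed.

Lemma strongly_measurable_restrict (f : T -> V) : strongly_measurable D ip f ->
  strongly_measurable setT ip (fun x => if x \in D then f x else 0).
Proof.
move=> [[c dense] mf]; split.
  (* Index 0 now carries the value taken outside [D]. *)
  exists (fun n => if n is m.+1 then c m else 0) => x _ e e0.
  case: ifPn => xD; last by exists 0%N; rewrite subrr ipnorm0.
  by have [m hm] := dense x (set_mem xD) e e0; exists m.+1.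
move=> v; rewrite (_ : (fun x => _) =
    fun x => ((fun x => `[f x - v] - `[v]) \_ D) x + `[v]).
  apply: measurable_funD => //; apply: (measurable_restrictT _ mD).1.
  exact: measurable_funB.
apply/funext => x; rewrite patchE; case: ifP => _; first by rewrite subrK.
by rewrite sub0r (ipnormN hip) add0r.
Qed.

End strong_measurability.

Section kernel_moments.
Context d (T : measurableType d) (R : realType) (P : probability T R).
Context (V : lmodType R) (ip : V -> V -> R) (hip : inner_product ip).
Context (cpl : ip_complete ip).
Context (f : T -> V) (fm : strongly_measurable setT ip f).

Local Notation "`[ u ]" := (ipnorm ip u) (format "`[ u ]").

Context (f2 : P.-integrable setT (EFin \o (fun x => `[f x] ^+ 2))).

Let K x y := ip (f x) (f y).

Let mf0 := measurable_ipnorm fm.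

Let f1 : P.-integrable setT (EFin \o (fun x => `[f x])).
Proof. exact: integrable_sqr_EFin. Qed.

(** Replacing the first argument by nearest-point simple functions turns the kernel into a finite
    sum of products of one-variable functions; the kernel is their pointwise limit. *)
Lemma measurable_ip_kernel :
  measurable_fun setT (fun z : T * T => ip (f z.1) (f z.2)).
Proof.
case: (fm) => -[c dense] _.
pose s := nearest_simple P measurableT fm c.
pose h n (z : T * T) := ip (vs_fun (s n) z.1) (f z.2).
apply: (@measurable_fun_cvg _ _ _ setT h) => [n|z _].
  rewrite (_ : h n = fun z => \sum_i ip (vs_val (v := s n) i) (f z.2) *
      \1_(vs_set (v := s n) i) z.1); last first.
    by apply/funext => z; rewrite /h (ip_vs_fun hip).
  apply: measurable_sum => i; apply: measurable_funM.
    apply: (measurableT_comp (f := fun y => ip _ (f y))) => //.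
    by under eq_fun do rewrite (ipC hip); exact: measurable_ip.
  have mi : measurable_fun setT (\1_(vs_set (v := s n) i) : T -> R).
    by apply: measurable_indic; exact: (@vs_measurable _ _ _ _ _ (s n)).
  exact: (measurableT_comp mi measurable_fst).
apply: (ipnorm_cvg_ip hip); apply/cvgrPdist_lt => e e0.
have [m hm] := dense z.1 I e e0.
exists m => // n /= mn; rewrite sub0r normrN ger0_norm ?ipnorm_ge0//.
have [k -> hk] := nearest_simpleE P measurableT fm c n (I : setT z.1).
by rewrite (ipnormBC hip) (le_lt_trans (hk m mn)).
Qed.

Lemma integrable_ip_kernel x : P.-integrable setT (EFin \o (fun y => ip (f x) (f y))).
Proof. by under eq_fun do rewrite (ipC hip); exact: integrable_ip. Qed.

Lemma ip_sqr_le u v : ip u v ^+ 2 <= `[u] ^+ 2 * `[v] ^+ 2.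
Proof.
rewrite -exprMn -(real_normK (num_real (ip u v))).
by rewrite ler_pXn2r ?nnegrE ?mulr_ge0 ?ipnorm_ge0// ip_cauchy_schwarz.
Qed.

Let f22 := integrable_prod_mul f2 f2.

Lemma integrable_ip_kernel_sqr : (P \x P)%E.-integrable setT
  (EFin \o (fun z => ip (f z.1) (f z.2) ^+ 2)).
Proof.
apply: (le_integrable_EFin _ f22) => [|z].
  exact: (measurable_funX 2 measurable_ip_kernel).
by rewrite ger0_norm ?sqr_ge0// ip_sqr_le.
Qed.

Let V2 := \int[(P \x P)%E]_z (K z.1 z.2 ^+ 2).

Lemma Rintegral_ip_kernel mu : (forall w, ip mu w = \int[P]_x ip (f x) w) ->
  \int[(P \x P)%E]_z ip (f z.1) (f z.2) = ip mu mu.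
Proof.
move=> muE; rewrite Rintegral_fubini.
- rewrite [RHS]muE; apply: eq_Rintegral => x _ /=; rewrite (ipC hip) muE.
  by apply: eq_Rintegral => y _; rewrite (ipC hip).
- exact: integrable_sqr_EFin measurable_ip_kernel integrable_ip_kernel_sqr.
- exact: integrable_ip_kernel.
Qed.

(** Weak form of [a = E (<f X, u> f X)], the uncentred covariance operator applied to [u]. *)
Definition second_moment (u a : V) :=
  forall w, ip a w = \int[P]_x (ip (f x) u * ip (f x) w).

Let mfu u : measurable_fun setT (fun x => ip (f x) u).
Proof. exact: measurable_ip. Qed.

Let fu2 u : P.-integrable setT (EFin \o (fun x => ip (f x) u ^+ 2)).
Proof.
apply: (le_integrable_EFin _ (integrable_mulr_EFin (`[u] ^+ 2) f2)) => [|x].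
  exact: measurable_funX.
by rewrite ger0_norm ?sqr_ge0// mulrC ip_sqr_le.
Qed.

Let fuw u w : P.-integrable setT (EFin \o (fun x => ip (f x) u * ip (f x) w)).
Proof. exact: (integrable_mul_sqr (mfu u) (mfu w) (fu2 u) (fu2 w)). Qed.

Let mguv u : measurable_fun setT (fun z : T * T => ip (f z.1) u * ip (f z.2) u).
Proof.
by apply: measurable_funM; [exact: (measurableT_comp (mfu u) measurable_fst)|
  exact: (measurableT_comp (mfu u) measurable_snd)].
Qed.

Let guv2 u : (P \x P)%E.-integrable setT
  (EFin \o (fun z => (ip (f z.1) u * ip (f z.2) u) ^+ 2)).
Proof.
by under eq_fun do rewrite exprMn; exact: (integrable_prod_mul (fu2 u) (fu2 u)).
Qed.

(** The weak identity is used twice: with [w = a], and then for the inner product [<a, f x>] inside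
    the integral. *)
Lemma ip_second_moment u a : second_moment u a ->
  ip a a = \int[(P \x P)%E]_z (ip (f z.1) u * ip (f z.2) u * ip (f z.1) (f z.2)).
Proof.
move=> ua; rewrite Rintegral_fubini /=.
- rewrite {1}ua; apply: eq_Rintegral => x _.
  under eq_Rintegral do rewrite -mulrA.
  rewrite RintegralZl//.
    rewrite (ipC hip (f x) a) ua; congr (_ * _); apply: eq_Rintegral => y _.
    by rewrite (ipC hip (f y) (f x)).
  under eq_fun do rewrite (ipC hip (f x)); exact: fuw.
- exact: (integrable_mul_sqr (mguv u) measurable_ip_kernel (guv2 u)
    integrable_ip_kernel_sqr).
- move=> x.
  apply: eq_integrable (integrable_mulr_EFin (ip (f x) u) (fuw u (f x))) => // y _.
  by rewrite /= -mulrA (ipC hip (f y) (f x)).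
Qed.

Lemma second_moment_le u a : second_moment u a ->
  \int[P]_x (ip (f x) u ^+ 2) <=
  ip u u * Num.sqrt (\int[(P \x P)%E]_z (ip (f z.1) (f z.2) ^+ 2)).
Proof.
move=> ua; set S := \int[P]_x _; set W := Num.sqrt _.
have SE : S = ip a u by rewrite ua; apply: eq_Rintegral => x _; rewrite expr2.
have S0 : 0 <= S by apply: Rintegral_ge0 => x _; exact: sqr_ge0.
have aaS : ip a a <= S * W.
  (* The other Cauchy-Schwarz factor, [E (<f X, u> <f Y, u>) ^ 2], splits into [S ^ 2] by
     independence. *)
  have := Rintegral_cauchy_schwarz (mguv u) measurable_ip_kernel (guv2 u)
    integrable_ip_kernel_sqr.
  rewrite -(ip_second_moment ua); under eq_Rintegral do rewrite exprMn.
  rewrite (Rintegral_prod_mul (fu2 u) (fu2 u)) -/S -expr2 => h.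
  rewrite -(ler_pXn2r (ltn0Sn 1)) ?nnegrE ?mulr_ge0 ?sqrtr_ge0 ?ip_ge0//.
  rewrite exprMn sqr_sqrtr//; apply: Rintegral_ge0 => z _; exact: sqr_ge0.
have SS : S ^+ 2 <= S * (ip u u * W).
  rewrite {1}SE (le_trans (ip_sqr_le _ _))// !(sqr_ipnorm hip).
  by rewrite mulrC mulrCA ler_wpM2l ?ip_ge0.
have [S_eq0|S_neq0] := eqVneq S 0.
  by rewrite S_eq0 mulr_ge0 ?ip_ge0// sqrtr_ge0.
have Sp : 0 < S by rewrite lt_def S_neq0.
by move: SS; rewrite expr2 ler_pM2l.
Qed.

Lemma kernel_sqr_le_esum (E : set V) (C : V -> V) : orthonormal_basis ip E ->
  (forall e, E e -> second_moment e (C e)) ->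
  ((\int[(P \x P)%E]_z (ip (f z.1) (f z.2) ^+ 2))%:E <=
   \esum_(e in E) (ip (C e) (C e))%:E)%E.
Proof.
move=> Eonb CE; case: (fm) => -[c dense] _.
(* [F N] nearly captures the first [N] points of the dense sequence. It is built one point at a
   time; enlarging a finite part never increases the residuals already controlled. *)
have /choice[F hF] (N : nat) : exists F, onseq E F /\
    forall m, (m < N)%N -> `[c m - oproj ip F (c m)] < N.+1%:R^-1.
  have n0 : 0 < N.+1%:R^-1 :> R by rewrite invr_gt0.
  suff h k : exists F, onseq E F /\
      forall m, (m < k)%N -> `[c m - oproj ip F (c m)] < N.+1%:R^-1 by exact: (h N).
  elim: k => [|k [F [oF Fk]]]; first by exists [::].
  have [G oG Gk] := oproj_dense hip Eonb (c k) cpl n0.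
  have oFG := onseq_cat oF oG; exists (undup (F ++ G)); split => // m.
  rewrite ltnS leq_eqVlt => /predU1P[->|/Fk]; last first.
    apply: le_lt_trans; apply: (ler_residual hip Eonb) => // x xF.
    by rewrite mem_undup mem_cat xF.
  apply: le_lt_trans Gk; apply: (ler_residual hip Eonb) => // x xG.
  by rewrite mem_undup mem_cat xG orbT.
pose KN n (z : T * T) := ip (oproj ip (F n) (f z.1)) (f z.2).
have oF n : onseq E (F n) by case: (hF n).
have KNE n z : KN n z = \sum_(e <- F n) ip (f z.1) e * ip (f z.2) e.
  rewrite /KN (ip_oproj hip); apply: eq_bigr => e _.
  by rewrite !(ipC hip e).
have mKN n : measurable_fun setT (KN n).
  rewrite (_ : KN n = fun z => \sum_(e <- F n) ip (f z.1) e * ip (f z.2) e).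
    exact: measurable_sum.
  by apply/funext => z; rewrite KNE.
have proj_cvg x : (fun n => `[oproj ip (F n) (f x) - f x]) @ \oo --> (0 : R).
  apply/cvgrPdist_lt => e e0; have e2 : 0 < e / 2 by rewrite divr_gt0.
  have [m hm] := dense x I _ e2.
  have [N _ hN] := near_infty_natSinv_lt (PosNum e2).
  exists (maxn m.+1 N) => // n /=; rewrite geq_max => /andP[mn Nn].
  rewrite sub0r normrN ger0_norm ?ipnorm_ge0// (ipnormBC hip).
  have [_ /(_ m mn) hFn] := hF n.
  (* The second residual is at most [|f x - c m|], and the first is small by the choice of [F n]. *)
  have -> : f x - oproj ip (F n) (f x) = (c m - oproj ip (F n) (c m)) +
      ((f x - c m) - oproj ip (F n) (f x - c m)).
    by rewrite (oprojB hip) opprB addrACA addKr [c m + _]addrC subrK.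
  rewrite (le_lt_trans (ler_ipnormD hip _ _))// (splitr e) ltrD//.
    exact: lt_trans hFn (hN _ Nn).
  by rewrite (le_lt_trans (ler_ipnorm_sub_oproj hip Eonb _ (oF n))).
have KN2 n : (P \x P)%E.-integrable setT (EFin \o (fun z => KN n z ^+ 2)).
  apply: (le_integrable_EFin _ f22) => [|z]; first exact: measurable_funX.
  rewrite ger0_norm ?sqr_ge0// (le_trans (ip_sqr_le _ _))// ler_wpM2r ?sqr_ge0//.
  rewrite ler_pXn2r ?nnegrE ?ipnorm_ge0//.
  exact: (ler_ipnorm_oproj hip Eonb _ (oF n)).
(* Each [|C e| ^ 2] is a double integral against the kernel; summing over [F n] assembles the
   truncated kernel [KN n]. *)
have sumE n : \sum_(e <- F n) ip (C e) (C e) =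
    \int[(P \x P)%E]_z (KN n z * ip (f z.1) (f z.2)).
  under eq_Rintegral do rewrite KNE big_distrl/=.
  rewrite (Rintegral_sum measurableT).
    rewrite big_seq [RHS]big_seq; apply: eq_bigr => e eF.
    by apply: ip_second_moment; apply: CE; case: (oF n) => _; apply.
  move=> e _; exact: (integrable_mul_sqr (mguv e) measurable_ip_kernel (guv2 e)
    integrable_ip_kernel_sqr).
pose g n z := (KN n z * ip (f z.1) (f z.2))%:E.
have mg n : measurable_fun setT (g n).
  by apply/measurable_EFinP/measurable_funM => //; exact: measurable_ip_kernel.
have mK2 : measurable_fun setT (fun z => (ip (f z.1) (f z.2) ^+ 2)%:E).
  by apply/measurable_EFinP/measurable_funX; exact: measurable_ip_kernel.
have [||_ _ lim] := @dominated_convergence _ _ _ (P \x P)%E setT measurableT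
  g _ _ mg mK2 _ f22.
- apply: aeW => z _; apply: cvg_EFin; first exact: nearW.
  by apply: cvgM; [exact: (ipnorm_cvg_ip hip)|exact: cvg_cst].
- apply: aeW => z n _ /=; rewrite lee_fin normrM.
  rewrite (le_trans (ler_pM _ _ (ip_cauchy_schwarz hip _ _)
    (ip_cauchy_schwarz hip _ _)))//.
  have pF : `[oproj ip (F n) (f z.1)] <= `[f z.1].
    exact: (ler_ipnorm_oproj hip Eonb _ (oF n)).
  rewrite -exprMn expr2 ler_wpM2r ?mulr_ge0 ?ipnorm_ge0//.
  by rewrite ler_wpM2r ?ipnorm_ge0.
have gE n : (\int[(P \x P)%E]_z g n z = (\sum_(e <- F n) ip (C e) (C e))%:E)%E.
  rewrite sumE EFin_Rintegral//.
  exact: (integrable_mul_sqr (mKN n) measurable_ip_kernel (KN2 n)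
    integrable_ip_kernel_sqr).
rewrite EFin_Rintegral; last exact: integrable_ip_kernel_sqr.
(* The integral of the squared kernel is a limit of finite partial sums, each bounded by the full
   sum over the basis. *)
rewrite -(cvg_lim _ lim)//; apply: lime_le; first by apply/cvg_ex; eexists; exact: lim.
apply: nearW => n /=; rewrite gE -sumEFin; have [uF FE] := oF n.
apply: esum_ge; exists [set` F n]; first by split; [exact: finite_seq|exact: FE].
by rewrite fsbig_seq.
Qed.

End kernel_moments.

(** * Regularity of the Stein feature map *)

Section directional_derivative.
Context (R : realType) (W : normedModType R) (F : W -> R) (x v : W).

Lemma is_derive_line t : derivable F (x + t *: v) v ->
  is_derive t 1 (fun s => F (x + s *: v)) ('D_v F (x + t *: v)).
Proof.
have E : (fun h => h^-1 *: (((fun s : R => F (x + s *: v)) \o shift t) (h *: 1) -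
      F (x + t *: v))) =
    (fun h : R => h^-1 *: ((F \o shift (x + t *: v)) (h *: v) - F (x + t *: v))).
  apply/funext => h; rewrite /shift /=; congr (_ *: (F _ - _)).
  by rewrite -[h%:A]/(h * 1) mulr1 scalerDl addrCA.
by move=> dF; split; rewrite /derivable /derive E.
Qed.

Lemma MVT_line h : 0 < h ->
  (forall t, 0 <= t <= h -> derivable F (x + t *: v) v) ->
  exists2 t, 0 < t < h & F (x + h *: v) - F x = h * 'D_v F (x + t *: v).
Proof.
move=> h0 dF; have dl t : 0 <= t <= h -> _ := fun th => is_derive_line (dF t th).
have [t||t] := @MVT R (fun s => F (x + s *: v)) (fun t => 'D_v F (x + t *: v)) 0 h h0.
- by rewrite in_itv/= => /andP[/ltW ? /ltW ?]; apply: dl; apply/andP.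
- apply: derivable_within_continuous => t; rewrite in_itv/= => th.
  by have [] := dl t th.
rewrite in_itv/= scale0r addr0 subr0 => th E; exists t => //.
by rewrite E mulrC.
Qed.

Lemma derive_cvg_seq : derivable F x v ->
  (fun n => n.+1%:R * (F (x + n.+1%:R^-1 *: v) - F x)) @ \oo --> 'D_v F x.
Proof.
(* The increments [1 / (n + 1)] tend to 0 without reaching it, as the punctured limit defining the
   derivative demands. *)
move=> dF; have h0 : (fun n => n.+1%:R^-1 : R) @ \oo --> (0 : R)^'.
  move=> A [e /= e0 eA]; have [N _ hN] := near_infty_natSinv_lt (PosNum e0).
  exists N => // n /hN /= lt; apply: eA => //=.
    by rewrite sub0r normrN ger0_norm.
have := cvg_comp _ _ h0 dF; rewrite /comp /=.
apply: cvg_trans; apply: near_eq_cvg; apply: nearW => n /=.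
by rewrite invrK /shift/= [x + _]addrC.
Qed.

End directional_derivative.

Section rkhs_theory.
Context (R : realType) (d : nat) (X : set 'rV[R]_d) (X_open : open X).
Context (k : 'rV[R]_d -> 'rV[R]_d -> R) (k_C11 : C11_on X k).
Context (Hk : completeNormedModType R) (ip : Hk -> Hk -> R).
Context (ev : Hk -> 'rV[R]_d -> R) (k_rkhs : is_rkhs X k ip ev).

Let hip : inner_product ip. Proof. by case: k_rkhs => -[]. Qed.

Let normE f : `|f| = ipnorm ip f. Proof. by case: k_rkhs => -[]. Qed.

(** Values on [X] determine an element of the RKHS, so any witness is the one chosen by
    [rkhs_elt]. *)
Lemma rkhs_eltE g h : (forall y, X y -> ev h y = g y) -> rkhs_elt X ev g = h.
Proof.
move=> hg; apply: xget_unique => // h' h'g.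
by case: k_rkhs => _ _ ext _; apply: ext => y Xy; rewrite hg// h'g.
Qed.

Local Notation feature x := (rkhs_elt X ev (k x)).

Lemma ip_feature x f : X x -> ip f (feature x) = ev f x.
Proof.
move=> Xx; case: k_rkhs => _ _ _ /(_ x Xx)[kx kxE rep].
by rewrite (rkhs_eltE kxE) rep.
Qed.

Lemma feature_gram x y : X x -> X y -> ip (feature x) (feature y) = k x y.
Proof.
move=> Xx Xy; rewrite ip_feature//.
case: k_rkhs => _ _ _ /(_ x Xx)[kx kxE _].
by rewrite (rkhs_eltE kxE) kxE.
Qed.

(** [|g x - g y| ^ 2 = 2 (G x x - G x y) - (G x x - G y y)], where each difference is below
    [e ^ 2 / 4] for [y] near [x]. *)
Lemma gram_continuous (g : 'rV[R]_d -> Hk) (G : 'rV[R]_d -> 'rV[R]_d -> R) :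
  (forall x y, X x -> X y -> ip (g x) (g y) = G x y) -> continuous_on2 X G ->
  forall x, X x -> {for x, continuous g}.
Proof.
move=> gG cG x Xx; apply/(@cvgrPdist_lt _ _ _ (nbhs x)) => e e0.
have e2 : 0 < e ^+ 2 / 4 by rewrite divr_gt0// exprn_gt0.
have /cvgrPdist_lt/(_ _ e2)[[A B] /= [nA nB] AB] := cG x x Xx Xx.
have nX : nbhs x X by exact: open_nbhs_nbhs.
apply: (@filterS _ (nbhs x) _ (X `&` (A `&` B))) => [y [Xy [Ay By]]|]; last first.
  by apply: filterI => //; exact: filterI.
have h1 : `|G x x - G y y| < e ^+ 2 / 4 by exact: (AB (y, y)).
have h2 : `|G x x - G x y| < e ^+ 2 / 4.
  by apply: (AB (x, y)); split => //; exact: nbhs_singleton.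
rewrite normE -(ltr_pXn2r (ltn0Sn 1)) ?nnegrE ?ipnorm_ge0 1?ltW//.
rewrite (sqr_ipnorm hip) (ipBl hip) !(ipBr hip) (ipC hip (g y)) !gG//.
move: h1 h2; rewrite !ltr_norml => /andP[? ?] /andP[? ?]; lra.
Qed.

Lemma feature_continuous x : X x -> {for x, continuous (fun z => feature z)}.
Proof.
by apply: (gram_continuous feature_gram); case: k_C11.
Qed.

Let segment_cvg (x v : 'rV[R]_d) :
  (fun n : nat => x + n.+1%:R^-1 *: v) @ \oo --> x.
Proof.
rewrite -[X in _ --> X]addr0 -[X in _ + X](scale0r v).
apply: cvgD; first exact: cvg_cst.
by apply: cvgZr_tmp; exact: cvg_harmonic.
Qed.

Let segment_near (x v : 'rV[R]_d) (A : set ('rV[R]_d * 'rV[R]_d)) :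
  nbhs (x, x) A -> exists2 e : R, 0 < e &
    forall s t, 0 <= s < e -> 0 <= t < e -> A (x + s *: v, x + t *: v).
Proof.
move=> [[B C] /= [nB nC] BC].
have line : (fun t : R => x + t *: v) @ (0 : R) --> x.
  rewrite -[X in _ --> X]addr0 -[X in _ + X](scale0r v).
  apply: cvgD; first exact: cvg_cst.
  by apply: cvgZr_tmp; exact: cvg_id.
have [e /= e0 eBC] := line _ (filterI nB nC).
exists e => // s t /andP[s0 se] /andP[t0 te]; apply: BC; split => /=.
  by have [] := eBC s _; rewrite /= ?sub0r ?normrN ?ger0_norm.
by have [] := eBC t _; rewrite /= ?sub0r ?normrN ?ger0_norm.
Qed.

Context (i : 'I_d).
Let v : 'rV[R]_d := basis_vec i.
Let D1 := partial1 k i.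
Let D12 := partial2 (partial1 k i) i.

Let D1_derivable x y : X x -> X y -> derivable (fun z => k z y) x v.
Proof. by case: k_C11 => _ /(_ i)[+ _] _ _; apply. Qed.

Let D12_derivable x y : X x -> X y -> derivable (fun z => D1 x z) y v.
Proof. by case: k_C11 => _ _ _ /(_ i i)[+ _]; apply. Qed.

Let D12_continuous : continuous_on2 X D12.
Proof. by case: k_C11 => _ _ _ /(_ i i)[]. Qed.

Let quot x (n : nat) : Hk :=
  n.+1%:R *: (feature (x + n.+1%:R^-1 *: v) - feature x).

(** The mean value theorem is applied in the first argument to [F], the increment of [k] in the
    second argument, and then in the second argument to the partial derivative so obtained. *)
Let mixed_difference x h h' : 0 < h -> 0 < h' ->
  (forall s t, 0 <= s <= h -> 0 <= t <= h' -> X (x + s *: v) /\ X (x + t *: v)) ->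
  exists s t, [/\ 0 < s < h, 0 < t < h' &
    k (x + h *: v) (x + h' *: v) - k (x + h *: v) x -
      (k x (x + h' *: v) - k x x) =
    h * h' * D12 (x + s *: v) (x + t *: v)].
Proof.
move=> h0 h'0 hX.
have Xl s : 0 <= s <= h -> X (x + s *: v).
  by move=> hs; have [] := hX s 0 hs; rewrite ?lexx ?ltW.
have Xr t : 0 <= t <= h' -> X (x + t *: v).
  by move=> ht; have [] := hX 0 t _ ht; rewrite ?lexx ?ltW.
have Xx : X x by have := Xl 0; rewrite scale0r addr0; apply; rewrite lexx ltW.
have Xh' : X (x + h' *: v) by apply: Xr; rewrite lexx ltW.
pose F z := k z (x + h' *: v) - k z x.
have dF z : X z -> is_derive z v F (D1 z (x + h' *: v) - D1 z x).
  move=> Xz; apply: is_deriveB; split => //; exact: D1_derivable.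
have [|s hs FE] := MVT_line (F := F) (x := x) (v := v) h0.
  by move=> t ht; have [] := dF _ (Xl _ ht).
have Xs : X (x + s *: v).
  by apply: Xl; case/andP: hs => /ltW -> /ltW ->.
have [|t ht GE] := MVT_line (F := D1 (x + s *: v)) (x := x) (v := v) h'0.
  by move=> t ht; apply: D12_derivable => //; exact: Xr.
exists s, t; split => //.
rewrite -[LHS]/(F (x + h *: v) - F x) FE -mulrA; congr (_ * _).
by have [_ ->] := dF _ Xs.
Qed.

(** The inner product of two difference quotients is a rescaled mixed difference of [k], that is,
    [D12] at a point near [(x, x)]; continuity of [D12] concludes. *)
Let quot_gram x (e : R) : X x -> 0 < e -> exists N, forall n m,
  (N <= n)%N -> (N <= m)%N -> `|ip (quot x n) (quot x m) - D12 x x| < e.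
Proof.
move=> Xx e0.
have nX : nbhs (x, x) (X `*` X).
  by exists (X, X) => //=; split; exact: open_nbhs_nbhs.
have /cvgrPdist_lt/(_ _ e0) nD := D12_continuous Xx Xx.
have [r r0 hr] := segment_near v (filterI nX nD).
have [N _ hN] := near_infty_natSinv_lt (PosNum r0); exists N => n m Nn Nm.
have [ln lm] := (hN _ Nn, hN _ Nm); rewrite /= in ln lm.
have pn : 0 < n.+1%:R^-1 :> R by rewrite invr_gt0.
have pm : 0 < m.+1%:R^-1 :> R by rewrite invr_gt0.
have hX s t : 0 <= s < r -> 0 <= t < r -> X (x + s *: v) /\ X (x + t *: v).
  by move=> hs ht; have [[]] := hr s t hs ht.
have [|s [t [hs ht E]]] := mixed_difference pn pm (x := x).
  move=> s t /andP[s0 sn] /andP[t0 tm]; apply: hX.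
    by rewrite s0 (le_lt_trans sn).
  by rewrite t0 (le_lt_trans tm).
have r00 : (0 : R) <= 0 < r by apply/andP.
have [Xn _] : X (x + n.+1%:R^-1 *: v) /\ X (x + 0 *: v).
  by apply: hX => //; rewrite ltW.
have [Xm _] : X (x + m.+1%:R^-1 *: v) /\ X (x + 0 *: v).
  by apply: hX => //; rewrite ltW.
have -> : ip (quot x n) (quot x m) = D12 (x + s *: v) (x + t *: v).
  rewrite /quot (ipZl hip) (ipZr hip) (ipBl hip) !(ipBr hip).
  rewrite !feature_gram// E.
  by field; rewrite -!(natrD _ 1) !pnatr_eq0.
have hs' : 0 <= s < r by case/andP: hs => /ltW -> /lt_trans ->.
have ht' : 0 <= t < r by case/andP: ht => /ltW -> /lt_trans ->.
by rewrite distrC; have [_] := hr s t hs' ht'.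
Qed.

Lemma partial_feature_exists x : X x -> exists2 g : Hk,
  quot x @ \oo --> g & forall y, X y -> ev g y = partial1 k i x y.
Proof.
move=> Xx; have qc : cvg (quot x @ \oo).
  apply/cauchy_cvgP/cauchyP => e e0.
  (* In [|q_N - q_m| ^ 2] the inner products carry weights 1, -2 and 1, and each is within
     [e ^ 2 / 4] of the common limit, so the total stays below [e ^ 2]. *)
  have e4 : 0 < e ^+ 2 / 4 by rewrite divr_gt0// exprn_gt0.
  have [N hN] := quot_gram Xx e4.
  exists (quot x N), N => // m /= Nm; have Nn := leqnn N.
  rewrite -ball_normE /= normE.
  rewrite -(ltr_pXn2r (ltn0Sn 1)) ?nnegrE ?ipnorm_ge0 1?ltW//.
  rewrite (sqr_ipnorm hip) (ipBl hip) !(ipBr hip) (ipC hip (quot x m) (quot x N)).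
  have := hN N N Nn Nn; have := hN N m Nn Nm; have := hN m m Nm Nm.
  rewrite !ltr_norml => /andP[? ?] /andP[? ?] /andP[? ?]; lra.
exists (lim (quot x @ \oo)) => // y Xy; rewrite -ip_feature//.
have c1 : (fun n => ip (quot x n) (feature y)) @ \oo -->
    ip (lim (quot x @ \oo)) (feature y).
  apply: (ipnorm_cvg_ip hip); under eq_fun do rewrite -normE.
  by apply/norm_cvg0P/subr_cvg0.
apply/esym/(cvg_unique _ _ c1) => //.
apply: cvg_trans (derive_cvg_seq (D1_derivable Xx Xy)).
apply: near_eq_cvg; have [N _ XN] := segment_cvg v (open_nbhs_nbhs (conj X_open Xx)).
exists N => // n /XN /= Xn.
by rewrite /quot (ipZl hip) (ipBl hip) !feature_gram.
Qed.

Local Notation partial_feature x := (rkhs_elt X ev (fun y => partial1 k i x y)).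

Lemma ip_partial_feature x y : X x -> X y ->
  ip (partial_feature x) (feature y) = partial1 k i x y.
Proof.
move=> Xx Xy; have [g _ gE] := partial_feature_exists Xx.
by rewrite (rkhs_eltE gE) ip_feature// gE.
Qed.

(** The feature at [y] is the limit of the quotients [quot y], and their inner products with the
    feature at [x] are difference quotients of [partial1 k i x] at [y]. *)
Lemma partial_feature_gram x y : X x -> X y ->
  ip (partial_feature x) (partial_feature y) = D12 x y.
Proof.
move=> Xx Xy; have [g gc gE] := partial_feature_exists Xy.
rewrite (rkhs_eltE gE).
have c1 : (fun n => ip (partial_feature x) (quot y n)) @ \oo -->
    ip (partial_feature x) g.
  under eq_fun do rewrite (ipC hip); rewrite (ipC hip).
  apply: (ipnorm_cvg_ip hip); under eq_fun do rewrite -normE.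
  by apply/norm_cvg0P/subr_cvg0.
apply/esym/(cvg_unique _ _ c1) => //.
apply: cvg_trans (derive_cvg_seq (D12_derivable Xx Xy)).
apply: near_eq_cvg; have [N _ XN] := segment_cvg v (open_nbhs_nbhs (conj X_open Xy)).
exists N => // n /XN /= Xn.
by rewrite /quot (ipZr hip) (ipBr hip) !ip_partial_feature.
Qed.

Lemma partial_feature_continuous x : X x ->
  {for x, continuous (fun z => partial_feature z)}.
Proof. exact: (gram_continuous partial_feature_gram). Qed.

End rkhs_theory.

Section product_hilbert.
Context (R : realType) (d : nat) (Hk : completeNormedModType R).
Context (ip : Hk -> Hk -> R) (hip : inner_product ip).
Context (normE : forall f : Hk, `|f| = ipnorm ip f).

Local Notation H := {ffun 'I_d -> Hk}.

Lemma inner_product_ipH : inner_product (ipH ip : H -> H -> R).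
Proof.
split=> [u v|a u v w|u|u u0].
- by apply: eq_bigr => i _; exact: ipC.
- rewrite /ipH mulr_sumr -big_split/=; apply: eq_bigr => i _.
  by rewrite !ffunE (ipDl hip) (ipZl hip).
- by apply: sumr_ge0 => i _; exact: ip_ge0.
- apply/ffunP => i; rewrite ffunE; apply: (ip_eq0 hip); apply/eqP.
  move/eqP : u0; rewrite psumr_eq0 => [/allP|j _]; last exact: ip_ge0.
  by apply; rewrite mem_index_enum.
Qed.

Lemma sqr_ipnorm_ipH (u : H) : ipnorm (ipH ip) u ^+ 2 = \sum_i `|u i| ^+ 2.
Proof.
rewrite (sqr_ipnorm inner_product_ipH) /ipH; apply: eq_bigr => i _.
by rewrite normE (sqr_ipnorm hip).
Qed.

Lemma ler_norm_ipH (u : H) i : `|u i| <= ipnorm (ipH ip) u.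
Proof.
rewrite -(ler_pXn2r (ltn0Sn 1)) ?nnegrE ?ipnorm_ge0// sqr_ipnorm_ipH.
by rewrite (bigD1 i)//= lerDl; apply: sumr_ge0 => j _; exact: sqr_ge0.
Qed.

Lemma ipnorm_ipH_cvg0 T (F : set_system T) (FF : Filter F) (g : T -> H) :
  (forall i, `|g x i| @[x --> F] --> (0 : R)) ->
  ipnorm (ipH ip) (g x) @[x --> F] --> (0 : R).
Proof.
move=> gi; rewrite (_ : (fun x => ipnorm (ipH ip) (g x)) =
    (fun x => Num.sqrt (\sum_i `|g x i| ^+ 2))); last first.
  apply/funext => x.
  by rewrite -sqr_ipnorm_ipH sqrtr_sqr ger0_norm// ipnorm_ge0.
rewrite -[X in _ --> X]sqrtr0.
apply: (@continuous_cvg _ _ _ F _ _ (@Num.sqrt R)); first exact: sqrt_continuous.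
(* The limit 0 is written as a sum so that the induction on the index list treats both sides
   alike. *)
rewrite [X in _ --> X](_ : 0 = \sum_(i < d) (0 : R) ^+ 2); last first.
  by rewrite big1// => i _; rewrite expr0n.
elim: (index_enum _) => [|i r ih].
  by under eq_fun do rewrite big_nil; rewrite big_nil; exact: cvg_cst.
under eq_fun do rewrite big_cons; rewrite big_cons; apply: cvgD => //.
by under eq_fun do rewrite expr2; rewrite expr2; apply: cvgM.
Qed.

Lemma ip_complete_ipH : ip_complete (ipH ip : H -> H -> R).
Proof.
move=> s sc; have c i : cvg ((fun n => s n i) @ \oo).
  apply/cauchy_cvgP/cauchyP => e e0; have [N hN] := sc e e0.
  exists (s N i), N => // m /= Nm; rewrite -ball_normE /=.
  have := ler_norm_ipH (s N - s m) i; rewrite !ffunE => /le_lt_trans; apply.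
  exact: hN.
exists [ffun i => lim ((fun n => s n i) @ \oo)].
apply: ipnorm_ipH_cvg0 => i; apply/norm_cvg0P.
under eq_fun do rewrite !ffunE.
exact/subr_cvg0.
Qed.

End product_hilbert.

Section continuous_strongly_measurable.
Context (R : realType) (d : nat) (X : set 'rV[R]_d) (X_open : open X).
Context (V : lmodType R) (ip : V -> V -> R) (hip : inner_product ip).

Local Notation "`[ u ]" := (ipnorm ip u) (format "`[ u ]").

Lemma open_borel_measurable : measurable (X : set (borel_rV R d)).
Proof. exact: sub_sigma_algebra. Qed.

Lemma continuous_borel_measurable (F : 'rV[R]_d -> R) :
  (forall x, X x -> {for x, continuous F}) ->
  measurable_fun (X : set (borel_rV R d)) (F : borel_rV R d -> R).
Proof.
move=> Fc; apply: (measurability _ (RGenOpens.measurableE R)).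
move=> _ [_ [a [b ->] <-]]; apply: sub_sigma_algebra.
rewrite openE => x [Xx Fx]; apply: (@filterI _ (nbhs x)).
  exact: open_nbhs_nbhs.
by apply: Fc => //; apply: open_nbhs_nbhs; split => //; exact: interval_open.
Qed.

Lemma continuous_strongly_measurable (f : 'rV[R]_d -> V) :
  (forall x, X x -> `[f y - f x] @[y --> x] --> (0 : R)) ->
  strongly_measurable (X : set (borel_rV R d)) ip f.
Proof.
move=> fc; split; last first.
  move=> v; apply: continuous_borel_measurable => x Xx.
  apply/(@cvgrPdist_lt _ _ _ (nbhs x)) => e e0.
  have /(@cvgrPdist_lt _ _ _ (nbhs x))/(_ _ e0) := fc x Xx.
  apply: (@filterS _ (nbhs x)) => y.
  rewrite sub0r normrN ger0_norm ?ipnorm_ge0//; apply: le_lt_trans.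
  rewrite ler_norml lerBlDl lerBrDl.
  have := ler_ipnormB hip (f x) (f y) v; have := ler_ipnormB hip (f y) (f x) v.
  rewrite (ipnormBC hip (f x) (f y)); lra.
(* The values of [f] at rational vectors. These vectors may lie outside [X]: continuity at [x]
   controls [f] on a full neighbourhood. *)
pose c n := if unpickle n is Some q then f (map_mx ratr (q : 'rV[rat]_d)) else 0.
exists c => x Xx e e0.
have := fc x Xx => /(@cvgrPdist_lt _ _ _ (nbhs x))/(_ _ e0).
move=> /nbhs_ballP[r /= r0 hr].
have /choice[q hq] (j : 'I_d) : exists q : rat, `|x 0 j - ratr q| < r.
  have /rat_in_itvoo[q] : x 0 j - r < x 0 j + r.
    by rewrite ltrBlDr -addrA ltrDl addr_gt0.
  by rewrite in_itv/= -ltr_distlC => hq; exists q.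
pose Q : 'rV[rat]_d := \row_j q j.
exists (pickle Q); rewrite /c pickleK.
have /hr /= : ball x r (map_mx ratr Q : 'rV[R]_d).
  split => // i j; rewrite !mxE ord1 -ball_normE/=; exact: hq.
by rewrite sub0r normrN ger0_norm ?ipnorm_ge0// (ipnormBC hip).
Qed.

End continuous_strongly_measurable.

Section stein_feature_measurable.
Context (R : realType) (d : nat) (X : set 'rV[R]_d) (X_open : open X).
Context (p0 : 'rV[R]_d -> R) (p0_C1 : C1_on X p0).
Context (p0_gt0 : forall x, X x -> 0 < p0 x).

(** By the chain rule the score is the partial derivative of [p0] divided by [p0] on [X]. As [X] is
    open, this formula holds near [x], so continuity of the quotient transfers. *)
Lemma score_continuous i x : X x -> {for x, continuous (fun z => score p0 z i)}.
Proof.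
move=> Xx; have scoreE z : X z -> score p0 z i = 'D_(basis_vec i) p0 z / p0 z.
  move=> Xz; have [dp _] := p0_C1 Xz.
  have dln : is_derive (p0 z) 1 (@ln R) (p0 z)^-1.
    by apply: is_derive1_ln; exact: p0_gt0.
  have dln' : differentiable (@ln R) (p0 z) by apply/derivable1_diffP; case: dln.
  rewrite /score deriveE; last exact: differentiable_comp.
  rewrite diff_comp//= -[X in _ = X / _]/('D_(basis_vec i) p0 z) deriveE//.
  rewrite -[LHS]/('d (@ln R) (p0 z) ('d p0 z (basis_vec i))).
  by rewrite diff1E// derive1E; case: dln => _ ->.
have [dp cp] := p0_C1 Xx.
have ratio : ('D_(basis_vec i) p0 z / p0 z) @[z --> x] --> score p0 x i.
  rewrite scoreE//; apply: (@cvgM _ _ (nbhs x)); first exact: cp.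
  apply: (@cvgV _ _ (nbhs x)); first by rewrite gt_eqF// p0_gt0.
  exact: differentiable_continuous.
apply: cvg_trans ratio; apply: (@near_eq_cvg _ _ (nbhs x) _).
have nX : nbhs x X by exact: open_nbhs_nbhs.
by apply: (@filterS _ (nbhs x) _ _ _ _ nX) => z Xz; rewrite scoreE.
Qed.

Context (k : 'rV[R]_d -> 'rV[R]_d -> R) (k_C11 : C11_on X k).
Context (Hk : completeNormedModType R) (ip : Hk -> Hk -> R).
Context (ev : Hk -> 'rV[R]_d -> R) (k_rkhs : is_rkhs X k ip ev).

Lemma stein_feature_strongly_measurable :
  strongly_measurable (X : set (borel_rV R d)) (ipH ip) (stein_feature X ev p0 k).
Proof.
have [[hip normE] _ _ _] := k_rkhs.
apply: continuous_strongly_measurable => //; first exact: inner_product_ipH.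
move=> x Xx; apply: (ipnorm_ipH_cvg0 hip normE (F := nbhs x) _) => i.
have c : stein_feature X ev p0 k y i @[y --> x] --> stein_feature X ev p0 k x i.
  rewrite ffunE (_ : (fun y => _) = fun y => score p0 y i *: rkhs_elt X ev (k y) +
      rkhs_elt X ev (fun z => partial1 k i y z)); last first.
    by apply/funext => y; rewrite ffunE.
  apply: (@cvgD _ _ _ (nbhs x)); last first.
    exact: (partial_feature_continuous X_open k_C11 k_rkhs (i := i) Xx).
  apply: (@cvgZ _ _ _ (nbhs x)); first exact: (score_continuous (i := i) Xx).
  exact: (feature_continuous X_open k_C11 k_rkhs Xx).
have := (@subr_cvg0 _ _ _ (nbhs x) _ _ _).2 c => /(_ _)/cvg_norm; rewrite normr0.
rewrite (_ : (fun y => `|_ - _|) = fun y =>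
  `|(stein_feature X ev p0 k y - stein_feature X ev p0 k x) i|) //.
have subE (u w : {ffun 'I_d -> Hk}) : (u - w) i = u i - w i by rewrite !ffunE.
by apply/funext => y; rewrite subE.
Qed.

End stein_feature_measurable.

(** * Restriction to the support and deviation bounds *)

Section bochner_restriction.
Context d (T : measurableType d) (R : realType) (P : probability T R).
Context (V : lmodType R) (ip : V -> V -> R) (hip : inner_product ip).
Context (cpl : ip_complete ip) (D : set T) (mD : measurable D).
Context (f : T -> V) (fm : strongly_measurable D ip f).

Local Notation "`[ u ]" := (ipnorm ip u) (format "`[ u ]").

Context (f2 : (\int[P]_(x in D) (ip (f x) (f x))%:E < +oo)%E).

(** Extension by zero turns integrals over [D] into integrals over the whole space, where the kernel
    moments are stated. *)
Let f0 x := if x \in D then f x else 0.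

Let ipf0 u w : (fun x => ip (f x) u * ip (f x) w) \_ D =
  (fun x => ip (f0 x) u * ip (f0 x) w).
Proof.
apply/funext => x; rewrite patchE /f0; case: ifP => // _.
by rewrite (ip0l hip) mul0r.
Qed.

Let f2D : P.-integrable D (EFin \o (fun x => `[f x] ^+ 2)).
Proof.
apply/integrableP; split.
  by apply/measurable_EFinP/measurable_funX; exact: measurable_ipnorm.
under eq_integral => x _ do rewrite /= ger0_norm ?sqr_ge0// (sqr_ipnorm hip).
exact: f2.
Qed.

Lemma integrable_sqr_restrict :
  P.-integrable setT (EFin \o (fun x => `[if x \in D then f x else 0] ^+ 2)).
Proof.
rewrite (_ : _ \o _ = (EFin \o (fun x => `[f x] ^+ 2)) \_ D).
  exact/(integrable_mkcond _ mD).
apply/funext => x; rewrite patchE /=; case: ifP => // _.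
by rewrite (ipnorm0 hip) expr0n.
Qed.

Let f1D : P.-integrable D (EFin \o (fun x => `[f x])).
Proof.
have := integrable_sqr_EFin (measurable_ipnorm (strongly_measurable_restrict mD hip fm))
  integrable_sqr_restrict.
rewrite (_ : _ \o _ = (EFin \o (fun x => `[f x])) \_ D).
  by move/(integrable_mkcond _ mD).
apply/funext => x; rewrite patchE /=; case: ifP => // _.
by rewrite (ipnorm0 hip).
Qed.

Lemma Rintegral_ip_restrict w : \int[P]_(x in D) ip (f x) w =
  \int[P]_x ip (if x \in D then f x else 0) w.
Proof.
rewrite Rintegral_mkcond; apply: eq_Rintegral => x _.
by rewrite patchE; case: ifP => // _; rewrite (ip0l hip).
Qed.

Lemma ip_bochner_restrict w : ip (bochner ip P D f) w =
  \int[P]_x ip (if x \in D then f x else 0) w.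
Proof. by rewrite (ip_bochner mD hip)// Rintegral_ip_restrict. Qed.

Lemma is_bochner_ip_restrict v w : is_bochner ip P D f v ->
  ip v w = \int[P]_x ip (if x \in D then f x else 0) w.
Proof.
move=> fv; rewrite -Rintegral_ip_restrict; apply: (is_bochner_ip mD hip fv).
exact: integrable_ip.
Qed.

(** The integrand [<f x, u> f x] has norm at most [|u| |f x| ^ 2], so its Bochner integral exists
    and can be tested against [w]. *)
Lemma second_moment_bochner u :
  second_moment P ip (fun x => if x \in D then f x else 0) u
    (bochner ip P D (fun x => tensor ip (f x) (f x) u)).
Proof.
move=> w; rewrite (ip_bochner mD hip)//.
- rewrite /tensor Rintegral_mkcond; apply: eq_Rintegral => x _.
  by rewrite -(congr1 (@^~ x) (ipf0 u w)) !patchE (ipZl hip).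
- exact/strongly_measurableZ/fm/measurable_ip.
- have fuD : P.-integrable D (EFin \o (fun x => `[u] * `[f x] ^+ 2)).
    by apply: eq_integrable (integrableZl mD `[u] f2D).
  apply: le_integrable fuD => //.
    apply/measurable_EFinP/(@measurable_ipnorm _ _ _ D _ ip).
    exact/strongly_measurableZ/fm/measurable_ip.
  move=> x _; rewrite /= lee_fin /tensor (ipnormZ hip).
  rewrite [leLHS]ger0_norm ?[leRHS]ger0_norm ?mulr_ge0 ?sqr_ge0 ?ipnorm_ge0//.
  rewrite expr2 mulrA ler_wpM2r ?ipnorm_ge0// mulrC.
  by rewrite (ip_cauchy_schwarz hip).
Qed.

End bochner_restriction.

Section sqrt_deviation.
Context (R : realType).

(** Factor [a ^ 2 - t ^ 2]; replacing [u] by its positive part does not move it away from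
    [t ^ 2 >= 0]. *)
Lemma sqrt_max0_dist (u t : R) : 0 <= t ->
  `|Num.sqrt (Num.max u 0) - t| * (Num.sqrt (Num.max u 0) + t) <= `|u - t ^+ 2|.
Proof.
move=> t0; set a := Num.sqrt _.
have a0 : 0 <= a by exact: sqrtr_ge0.
have a2 : a ^+ 2 = Num.max u 0 by rewrite sqr_sqrtr// le_max lexx orbT.
rewrite -[a + t]ger0_norm ?addr_ge0// -normrM -subr_sqr a2.
have [u0|u0] := leP 0 u; first by [].
rewrite sub0r normrN [leLHS]ger0_norm ?sqr_ge0//.
by rewrite ltr0_norm ?subr_lt0 ?(lt_le_trans u0) ?sqr_ge0// opprB lerBrDl gerDr ltW.
Qed.

(** For nonnegative [a] and [t], [|a - t| <= a + t], so the previous product dominates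
    [|a - t| ^ 2]. *)
Lemma sqrt_max0_dist_sqrt (u t : R) : 0 <= t ->
  `|Num.sqrt (Num.max u 0) - t| <= Num.sqrt `|u - t ^+ 2|.
Proof.
move=> t0; have h := sqrt_max0_dist u t0.
rewrite -[leLHS]ger0_norm// -sqrtr_sqr ler_wsqrtr//; apply: le_trans h.
rewrite expr2 ler_wpM2l// ler_norml.
have := sqrtr_ge0 (Num.max u 0); lra.
Qed.

Context d (Omega : measurableType d) (Pr : probability Omega R).
Context (U : Omega -> R) (mU : measurable_fun setT U).
Context (U2 : Pr.-integrable setT (EFin \o (fun w => U w ^+ 2))).
Context (t : R) (t0 : 0 <= t).

Let Z w := U w - t ^+ 2.

Let mZ : measurable_fun setT Z.
Proof. exact: measurable_funB. Qed.

Let U1 : Pr.-integrable setT (EFin \o U). Proof. exact: integrable_sqr_EFin. Qed.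

Lemma integrable_sqr_deviation : Pr.-integrable setT (EFin \o (fun w => Z w ^+ 2)).
Proof.
have -> : (fun w => Z w ^+ 2) =
    (fun w => U w ^+ 2 - (2 * t ^+ 2 * U w - t ^+ 2 ^+ 2)).
  by apply/funext => w; rewrite /Z; ring.
apply: integrableB_EFin => //; apply: integrableB_EFin.
  exact: integrable_mulr_EFin.
exact: integrable_cst_EFin.
Qed.

Let Z2 := integrable_sqr_deviation.

Let mS : measurable_fun setT (@Num.sqrt R).
Proof. exact: continuous_measurable_fun (@sqrt_continuous R). Qed.

Let dev w := `|Num.sqrt (Num.max (U w) 0) - t|.

Let mabsZ : measurable_fun setT (fun w => `|Z w|).
Proof. exact: measurableT_comp. Qed.

Let absZ2 : Pr.-integrable setT (EFin \o (fun w => `|Z w| ^+ 2)).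
Proof. by under eq_fun do rewrite real_normK ?num_real//; exact: Z2. Qed.

Let absZ1 : Pr.-integrable setT (EFin \o (fun w => `|Z w|)).
Proof. exact: integrable_sqr_EFin. Qed.

Let mdev : measurable_fun setT dev.
Proof.
apply: measurableT_comp => //; apply: measurable_funB => //.
by apply: (measurableT_comp mS); exact: measurable_maxr.
Qed.

Let sqrtZ2 : Pr.-integrable setT (EFin \o (fun w => Num.sqrt `|Z w| ^+ 2)).
Proof. by under eq_fun do rewrite sqr_sqrtr//; exact: absZ1. Qed.

Let msqrtZ : measurable_fun setT (fun w => Num.sqrt `|Z w|).
Proof. exact: (measurableT_comp mS). Qed.

Lemma integrable_deviation : Pr.-integrable setT (EFin \o dev).
Proof.
apply: (le_integrable_EFin mdev (integrable_sqr_EFin msqrtZ sqrtZ2)) => w.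
by rewrite normr_id sqrt_max0_dist_sqrt.
Qed.

Let absZ_le : \int[Pr]_w `|Z w| <= Num.sqrt (\int[Pr]_w (Z w ^+ 2)).
Proof.
rewrite (le_trans (Rintegral_le_sqrt mabsZ absZ2))//.
by under eq_Rintegral do rewrite real_normK ?num_real//.
Qed.

(** The first moment is bounded by the root of the second twice, for the square root of [|Z|] and
    then for [|Z|]; hence the fourth root. *)
Lemma Rintegral_deviation_le : \int[Pr]_w dev w <=
  Num.sqrt (Num.sqrt (\int[Pr]_w ((U w - t ^+ 2) ^+ 2))).
Proof.
apply: (@le_trans _ _ (\int[Pr]_w Num.sqrt `|Z w|)).
  apply: le_Rintegral => //; first exact: integrable_deviation.
    exact: integrable_sqr_EFin.
  by move=> w _; exact: sqrt_max0_dist_sqrt.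
rewrite (le_trans (Rintegral_le_sqrt msqrtZ sqrtZ2))// ler_wsqrtr//.
under eq_Rintegral do rewrite sqr_sqrtr//.
exact: absZ_le.
Qed.

(** In [sqrt_max0_dist] the factor [sqrt (max u 0) + t] is bounded below by [t]. *)
Lemma Rintegral_deviation_le_div : 0 < t -> \int[Pr]_w dev w <=
  Num.sqrt (\int[Pr]_w ((U w - t ^+ 2) ^+ 2)) / t.
Proof.
move=> tp; rewrite ler_pdivlMr// mulrC -RintegralZl//; last exact: integrable_deviation.
apply: le_trans absZ_le; apply: le_Rintegral => //.
  exact: integrable_mulr_EFin integrable_deviation.
move=> w _; apply: le_trans (sqrt_max0_dist (U w) t0).
by rewrite mulrC ler_wpM2l ?lerDr ?sqrtr_ge0//; exact: normr_ge0.
Qed.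

End sqrt_deviation.

(** * Comparison of constants and assembly of the bounds *)

Lemma inv_pairs_gt0 (R : realType) (n : nat) : (2 <= n)%N ->
  0 < 2 / (n%:R * (n%:R - 1)) :> R.
Proof.
move=> n2; have n0 : 0 < n%:R :> R by rewrite ltr0n (leq_trans _ n2).
by rewrite divr_gt0 ?mulr_gt0// subr_gt0 ltr1n.
Qed.

Lemma ge0_le_poweR (R : realType) (x y : \bar R) (r : R) : 0 <= r ->
  (0 <= x)%E -> (x <= y)%E -> (poweR x r <= poweR y r)%E.
Proof.
move=> r0 x0 xy; apply: gt0_ler_poweR => //; rewrite in_itv/= leey andbT//.
exact: le_trans xy.
Qed.

(** For finite [S], raising both sides to the fourth power reduces the claim to
    [2 / (n (n - 1)) <= 4 / n ^ 2], that is, [n >= 2]. For infinite [S] the right-hand side is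
    infinite. *)
Lemma hs_norm_bound (R : realType) (n : nat) (S : \bar R) : (2 <= n)%N ->
  (0 <= S)%E ->
  (poweR ((2 / (n%:R * (n%:R - 1)))%:E * S) (4^-1)%R <=
   (Num.sqrt 2)%:E * poweR (poweR S (2^-1)%R * (n%:R^-1)%:E) (2^-1)%R)%E.
Proof.
move=> n2; have n0 : 0 < n%:R :> R by rewrite ltr0n (leq_trans _ n2).
have n1 : 0 < n%:R - 1 :> R by rewrite subr_gt0 ltr1n.
have n2' : 2 <= n%:R :> R by rewrite ler_nat.
have a0 : 0 < 2 / (n%:R * (n%:R - 1)) :> R by exact: inv_pairs_gt0.
have n01 : 0 <= n%:R * (n%:R - 1) :> R by rewrite mulr_ge0 ?ltW.
have s2 : 0 < Num.sqrt 2 :> R by rewrite sqrtr_gt0.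
case: S => [s| |]//; last first.
  move=> _; rewrite gt0_muley ?lte_fin// !poweRyr// gt0_mulye ?lte_fin ?invr_gt0//.
  by rewrite poweRyr// gt0_muley ?lte_fin// leey.
rewrite lee_fin => s0; rewrite -EFinM !poweR_EFin -EFinM lee_fin.
have -> : 4^-1 = 2^-1 * 2^-1 :> R by field.
rewrite powRrM !powR12_sqrt ?mulr_ge0 ?sqrtr_ge0 ?invr_ge0 ?(ltW a0) ?(ltW n0)//.
rewrite -sqrtrM ?ler_wsqrtr//.
rewrite -[leRHS]ger0_norm ?mulr_ge0 ?sqrtr_ge0 ?invr_ge0 ?(ltW n0)//.
rewrite -sqrtr_sqr ler_wsqrtr// !exprMn sqr_sqrtr// mulrCA mulrC ler_wpM2l//.
rewrite ler_pdivrMr ?mulr_gt0// exprVn.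
have -> : 2 ^+ 2 * (n%:R ^+ 2)^-1 * (n%:R * (n%:R - 1)) = 4 * (n%:R - 1) / n%:R :> R.
  by field; rewrite gt_eqF.
by rewrite ler_pdivlMr//; lra.
Qed.

Theorem theorem2 (R : realType) (d : nat)
  (X : set 'rV[R]_d) (X_open : open X)
  (P0 : probability (borel_rV R d) R) (P0X : P0 X = 1%E)
  (p0 : 'rV[R]_d -> R) (p0_C1 : C1_on X p0)
  (p0_gt0 : forall x, X x -> 0 < p0 x) (p0_density : has_density P0 X p0)
  (k : 'rV[R]_d -> 'rV[R]_d -> R) (k_C11 : C11_on X k)
  (k_posdef : pos_def_kernel X k)
  (Hk : completeNormedModType R) (ip : Hk -> Hk -> R)
  (ev : Hk -> 'rV[R]_d -> R) (k_rkhs : is_rkhs X k ip ev) :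
  let xi := stein_feature X ev p0 k in
  let K := stein_kernel X ip ev p0 k in
  let C := stein_covariance X ip ev p0 k P0 in
  forall (P0K : (\int[P0]_(x in X) (K x x)%:E < +oo)%E)
    (stein_identity : is_bochner (ipH ip) P0 X xi 0)
    (P : probability (borel_rV R d) R) (PX : P X = 1%E)
    (PK : (\int[P]_(x in X) (K x x)%:E < +oo)%E),
  let theta := ksd X ip ev p0 k P in
  let V := (\int[P \x P]_(z in X `*` X) (K z.1 z.2 ^+ 2)%:E)%E in
  forall (V_fin : (V < +oo)%E)
    (n : nat) (n_ge2 : (2 <= n)%N)
    (disp : measure_display) (Omega : measurableType disp)
    (Pr : probability Omega R) (Xs : 'I_n -> {RV Pr >-> borel_rV R d})
    (Xs_iid : iid P Xs) (Xs_X : forall i w, X (Xs i w)),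
  let U := ustat K Xs in
  let KSDU := ksd_hat K Xs in
  [/\ ('E_Pr[U] = (theta ^+ 2)%:E)%E,
      ('V_Pr[U] <= (4 * theta ^+ 2 / n%:R)%:E * poweR V (2^-1)%R
                   + (2 / (n%:R * (n%:R - 1)))%:E * V)%E,
      ('E_Pr[(fun w => `|KSDU w - theta|)%R] <= poweR ('V_Pr[U]) (4^-1)%R)%E,
      0 < theta ->
        ('E_Pr[(fun w => `|KSDU w - theta|)%R]
           <= poweR ('V_Pr[U]) (2^-1)%R * (theta^-1)%:E)%E &
      P = P0 ->
        ('E_Pr[(fun w => `|KSDU w|)%R]
           <= poweR ((2 / (n%:R * (n%:R - 1)))%:E * trace (ipH ip) (C \o C))
                (4^-1)%R)%E /\
        (poweR ((2 / (n%:R * (n%:R - 1)))%:E * trace (ipH ip) (C \o C))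
               (4^-1)%R
           <= (Num.sqrt 2)%:E *
              poweR (hs_norm (ipH ip) C * (n%:R^-1)%:E) (2^-1)%R)%E].
Proof.
move=> xi K C P0K stein_identity P PX PK theta V V_fin n n_ge2 disp Omega Pr Xs.
move=> Xs_iid Xs_X U KSDU.
have [[hipk normE] _ _ _] := k_rkhs.
have hip := inner_product_ipH d hipk.
have cpl : ip_complete (ipH ip : {ffun 'I_d -> Hk} -> _ -> _) by exact: ip_complete_ipH.
have mX := open_borel_measurable X_open.
have xim : strongly_measurable (X : set (borel_rV R d)) (ipH ip) xi.
  exact: (stein_feature_strongly_measurable X_open p0_C1 p0_gt0 k_C11 k_rkhs).
pose f (x : borel_rV R d) := if x \in X then xi x else 0.
have fm : strongly_measurable setT (ipH ip) f by exact: strongly_measurable_restrict.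
have f2 : P.-integrable setT (EFin \o (fun x => ipnorm (ipH ip) (f x) ^+ 2)).
  exact: (integrable_sqr_restrict hip mX xim PK).
pose mu := mean_embedding X ip ev p0 k P.
have muE w : ipH ip mu w = \int[P]_x ipH ip (f x) w.
  exact: (ip_bochner_restrict hip cpl mX xim PK).
pose K0 (x y : borel_rV R d) := ipH ip (f x) (f y).
have K0E x y : X x -> X y -> K0 x y = K x y.
  by move=> Xx Xy; rewrite /K0 /f !mem_set.
have K0sym x y : K0 x y = K0 y x by rewrite /K0 (ipC hip).
have mK0 := measurable_ip_kernel P hip fm.
have K02 := integrable_ip_kernel_sqr hip fm f2.
have K01 := integrable_ip_kernel hip fm f2.
pose V2 := \int[(P \x P)%E]_z (K0 z.1 z.2 ^+ 2).
have V20 : 0 <= V2 by apply: Rintegral_ge0 => z _; exact: sqr_ge0.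
(* The extended kernel vanishes off [X * X], so restricting the domain of integration changes
   nothing. *)
have VE : V = V2%:E.
  rewrite /V2 EFin_Rintegral// /V [LHS]integral_mkcond; apply: eq_integral => z _.
  rewrite patchE; case: ifPn => [|zX]; first by rewrite inE => -[Xx Xy]; rewrite K0E.
  suff -> : K0 z.1 z.2 = 0 by rewrite expr0n.
  rewrite /K0 /f; case: ifPn => Xx; last by rewrite (ip0l hip).
  case: ifPn => Xy; last by rewrite (ip0r hip).
  by move: zX; rewrite notin_setE; case; split; exact: set_mem.
have m1E : \int[(P \x P)%E]_z K0 z.1 z.2 = theta ^+ 2.
  by rewrite (Rintegral_ip_kernel hip fm f2 muE) (sqr_ipnorm hip).
have theta0 : 0 <= theta by exact: ipnorm_ge0.
(* The inner integral is [<f x, mu>], so this is the quadratic form of the second moment operator of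
   [P] at [mu]. *)
have S_le : \int[P]_x ((\int[P]_y K0 x y) ^+ 2) <= theta ^+ 2 * Num.sqrt V2.
  have -> : \int[P]_x ((\int[P]_y K0 x y) ^+ 2) = \int[P]_x (ipH ip (f x) mu ^+ 2).
    apply: eq_Rintegral => x _; congr (_ ^+ 2); rewrite (ipC hip) muE.
    by apply: eq_Rintegral => y _; rewrite /K0 (ipC hip).
  rewrite (sqr_ipnorm hip).
  exact: (second_moment_le hip fm f2 (second_moment_bochner hip cpl mX xim PK mu)).
have mXs i : measurable_fun setT (Xs i) by exact: measurable_funPT.
have [Xs_law Xs_indep] := Xs_iid.
(* All sample points lie in [X], where the extended kernel equals the Stein kernel. *)
have UE : U = fun w => (n%:R * (n%:R - 1))^-1 *
    \sum_(i < n) \sum_(j < n | i != j) K0 (Xs i w) (Xs j w).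
  apply/funext => w; rewrite /U /ustat; congr (_ * _).
  by apply: eq_bigr => i _; apply: eq_bigr => j _; rewrite K0E.
have mU : measurable_fun setT U.
  by rewrite UE; exact: (measurable_ustat mXs mK0).
have U2 : Pr.-integrable setT (EFin \o (fun w => U w ^+ 2)).
  by rewrite UE; exact: (integrable_ustat_sqr mXs Xs_law Xs_indep mK0 K02).
have U1 : Pr.-integrable setT (EFin \o U) by exact: integrable_sqr_EFin.
have EU : ('E_Pr[U] = (theta ^+ 2)%:E)%E.
  rewrite unlock -EFin_Rintegral// -m1E; congr EFin; rewrite UE.
  exact: (Rintegral_ustat mXs Xs_law Xs_indep mK0 K02).
pose Z := \int[Pr]_w ((U w - theta ^+ 2) ^+ 2).
have Z0 : 0 <= Z by apply: Rintegral_ge0 => w _; exact: sqr_ge0.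
have VU : ('V_Pr[U] = Z%:E)%E.
  rewrite /variance unlock EU /= unlock /Z EFin_Rintegral//.
  exact: integrable_sqr_deviation.
have Zle : Z <= 4 * theta ^+ 2 / n%:R * Num.sqrt V2 + 2 / (n%:R * (n%:R - 1)) * V2.
  apply: (@le_trans _ _ (4 * \int[P]_x ((\int[P]_y K0 x y) ^+ 2) / n%:R +
      2 / (n%:R * (n%:R - 1)) * V2)).
    rewrite /Z UE -m1E.
    exact: (Rintegral_ustat_var mXs Xs_law Xs_indep K0sym mK0 K02 K01 n_ge2).
  by rewrite lerD2r [leRHS]mulrAC ler_wpM2r ?invr_ge0// -mulrA ler_wpM2l.
have dev_int := integrable_deviation mU U2 theta0.
have Edev : ('E_Pr[(fun w => `|KSDU w - theta|)%R] =
    (\int[Pr]_w `|Num.sqrt (Num.max (U w) 0) - theta|)%:E)%E.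
  by rewrite unlock EFin_Rintegral.
have quarter (z : R) : 0 <= z -> poweR z%:E (4^-1)%R = (Num.sqrt (Num.sqrt z))%:E.
  move=> z0; have -> : 4^-1 = 2^-1 * 2^-1 :> R by field.
  by rewrite poweR_EFin powRrM !powR12_sqrt// powR_ge0.
have half (z : R) : 0 <= z -> poweR z%:E (2^-1)%R = (Num.sqrt z)%:E.
  by move=> z0; rewrite poweR_EFin powR12_sqrt.
have dev_le : ('E_Pr[(fun w => `|KSDU w - theta|)%R] <= poweR ('V_Pr[U]) (4^-1)%R)%E.
  by rewrite Edev VU quarter// lee_fin; exact: Rintegral_deviation_le.
have Var_le : ('V_Pr[U] <= (4 * theta ^+ 2 / n%:R)%:E * poweR V (2^-1)%R
                   + (2 / (n%:R * (n%:R - 1)))%:E * V)%E.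
  by rewrite VU VE half// -!EFinM -EFinD lee_fin.
split => //.
  move=> tp; rewrite Edev VU half// -EFinM lee_fin.
  exact: Rintegral_deviation_le_div.
move=> PP0; subst P.
(* Stein's identity makes 0 a Bochner integral of [xi]. Both [mu] and 0 satisfy the same scalar
   identity tested against [mu], whence [<mu, mu> = <0, mu> = 0]. *)
have theta_eq0 : theta = 0.
  apply/eqP; rewrite -sqrf_eq0 (sqr_ipnorm hip) -/mu muE.
  rewrite -(is_bochner_ip_restrict hip mX xim PK mu stein_identity).
  by rewrite (ip0l hip).
have CE u : second_moment P0 (ipH ip) f u (C u).
  exact: (second_moment_bochner hip cpl mX xim PK u).
have Csym u w : ipH ip (C u) w = ipH ip u (C w).
  by rewrite CE (ipC hip) CE; apply: eq_Rintegral => x _; rewrite mulrC.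
(* Since [C] is symmetric, [<e, C (C e)> = |C e| ^ 2]: this sum is both the trace of the square and
   the squared Hilbert-Schmidt norm. *)
set S := (\esum_(e in onb (ipH ip)) (ipH ip (C e) (C e))%:E)%E.
have traceE : trace (ipH ip) (C \o C) = S.
  by apply: eq_esum => e _; rewrite /= Csym.
have hsE : hs_norm (ipH ip) C = poweR S (2^-1)%R.
  by congr poweR; apply: eq_esum => e _; rewrite (sqr_ipnorm hip).
have VS : (V2%:E <= S)%E.
  by apply: (kernel_sqr_le_esum hip cpl fm f2 (onbP hip)) => e _; exact: CE.
have S0 : (0 <= S)%E by apply: esum_ge0 => e _; rewrite lee_fin ip_ge0.
rewrite traceE hsE; split; last exact: hs_norm_bound.
have -> : (fun w => `|KSDU w|) = (fun w => `|KSDU w - theta|).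
  by apply/funext => w; rewrite theta_eq0 subr0.
have n01 := ltW (inv_pairs_gt0 R n_ge2).
apply: (le_trans dev_le).
have r4 : 0 <= 4^-1 :> R by rewrite invr_ge0.
have v0 : (0 <= 'V_Pr[U])%E by rewrite VU lee_fin.
apply: (ge0_le_poweR r4 v0); rewrite VU.
have ZV : Z <= 2 / (n%:R * (n%:R - 1)) * V2.
  by apply: (le_trans Zle); rewrite theta_eq0 expr0n/= mulr0 !mul0r add0r.
apply: (@le_trans _ _ ((2 / (n%:R * (n%:R - 1)))%:E * V2%:E)%E).
  by rewrite -EFinM lee_fin.
by apply: lee_wpmul2l => //; rewrite lee_fin.
Qed.
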